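(* Let $\tilde G$ be a finite or infinite graph with bounded valence. Let $G$ be a subgraph of $\tilde G$ such that the boundaries $\partial G$ and $\partial(G\setminus\partial G)$ are finite. Let $\tilde H(v_1,v_2;t)$ denote the heat kernel on $\tilde G$. For $(v_1,v_2;t)\in VG\times VG\times[0,\infty)$ define $$H_0(v_1,v_2;t):=\begin{cases}\tilde H(v_1,v_2;t), & v_1\in VG\setminus\partial G,\ v_2\in VG,\ t\geq0,\\ 0, & \text{otherwise.}\end{cases}$$ Then the series $$F(v_1,v_2;t):=\sum_{\ell=1}^{\infty}(-1)^{\ell}(L_{G,v_1}H_0)^{\ast\ell}(v_1,v_2;t)$$ converges absolutely and uniformly on any compact subset of $VG\times VG\times[0,\infty)$. Furthermore, the Dirichlet heat kernel $H_{D,G}(v_1,v_2;t)$ on $G$ is given by $$H_{D,G}(v_1,v_2;t)=H_0(v_1,v_2;t)+(H_0\ast F)(v_1,v_2;t).$$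
   Context: $\tilde G$ is a weighted graph with vertex set $V\tilde G$ (discrete topology) and symmetric weight function $\tilde w_{xy}=\tilde w_{yx}\in[0,\infty)$. Bounded valence means: for every $x$ the function $\tilde w(x,\cdot)$ has finite support, and $\tilde\mu(x)=\sum_{y\in V\tilde G}\tilde w_{xy}$ is uniformly bounded in $x$. A subgraph $G$ is given by a subset $VG\subseteq V\tilde G$ and a (symmetric) weight function $w$ on $VG\times VG$ with each $w_{xy}$ equal either to $\tilde w_{xy}$ or to $0$. Put $\mu(x)=\sum_{y\in VG}w_{xy}$; the boundary is $\partial G=\{x\in VG:\mu(x)<\tilde\mu(x)\}$. $G\setminus\partial G$ denotes the subgraph of $G$ with vertex set $VG\setminus\partial G$ and edges (weights) inherited from $G$; its boundary as a subgraph of $G$ is $\partial(G\setminus\partial G)=\{x\in VG\setminus\partial G:\sum_{y\in VG\setminus\partial G}w_{xy}<\mu(x)\}$. Laplacians: $\Delta_{\tilde G}f(x)=\sum_{y\in V\tilde G}(f(x)-f(y))\tilde w_{xy}$ and $\Delta_Gf(x)=\sum_{y\in VG}(f(x)-f(y))w_{xy}$; $L_{G,v_1}=\Delta_{G,v_1}+\partial_t$ acts in the first variable $v_1$. The heat kernel $\tilde H$ of $\tilde G$ is the fundamental solution of $(\Delta_{\tilde G,v_1}+\partial_t)\tilde H(v_1,v_2;t)=0$ with $\lim_{t\to0}\tilde H(v_1,v_2;t)=\delta_{v_1=v_2}$; it exists and is unique (as bounded solution), and it is the kernel of the semigroup $e^{-t\Delta_{\tilde G}}$ on $L^2(V\tilde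 G)$ (counting measure). The Dirichlet heat kernel $H_{D,G}(v_1,v_2;t)$ on $VG\times VG\times[0,\infty)$ is the solution of $L_{G,v_1}H_{D,G}(v_1,v_2;t)=0$ for $v_1\in VG\setminus\partial G$, with $\lim_{t\to0}H_{D,G}(v_1,v_2;t)=\delta_{v_1=v_2}$ for $v_1\in VG\setminus\partial G$, and $H_{D,G}(v_1,v_2;t)=0$ for all $v_2\in VG$ and $t\geq0$ whenever $v_1\in\partial G$. (It exists and is unique; when $G$ is infinite, uniqueness is among solutions that, for each fixed $v_2$ and $T>0$, are bounded in $(v_1,t)\in VG\times[0,T]$.) Convolution: $(F_1\ast F_2)(v_1,v_2;t)=\int_0^t\sum_{v\in VG}F_1(v_1,v;t-r)F_2(v,v_2;r)\,dr$; $(f)^{\ast1}=f$ and $(f)^{\ast\ell}=(f)^{\ast(\ell-1)}\ast f$ for $\ell\ge2$. (The sums appearing in the claim are finite, since $L_{G,v_1}H_0(v_1,v_2;t)$ vanishes for $v_1\notin\partial G\cup\partial(G\setminus\partial G)$.) *)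

(* Defs.v *)
From mathcomp Require Import all_boot all_order all_algebra.
From mathcomp Require Import all_classical all_reals all_analysis.

Set Implicit Arguments.
Unset Strict Implicit.
Unset Printing Implicit Defensive.

Import Order.TTheory GRing.Theory Num.Theory.
Import numFieldNormedType.Exports.

Local Open Scope classical_set_scope.
Local Open Scope ring_scope.

(* Triples (v1, v2, t), the vertex type [V] being discrete. The space of the
   series is its closed subspace [spacetime_domain A] below, whose compact
   subsets are the compact subsets of [spacetime R V] contained in it. *)
Notation spacetime R V :=
  (discrete_topology V * discrete_topology V * R)%type.

Section WeightedGraphs.
Variables (R : realType) (V : choiceType).

(* A weighted graph is a vertex set [A : set V] together with a weight
   function [w : V -> V -> R], of which only the values on [A * A] matter.
   All sums over [A] are finitely supported sums ([fsbigop]); they are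
   sums over finitely many terms as soon as every [w x] has finite support. *)

Definition valence (A : set V) (w : V -> V -> R) (x : V) : R :=
  \sum_(y \in A) w x y.

Definition weighted_graph (A : set V) (w : V -> V -> R) : Prop :=
  (forall x y, A x -> A y -> w x y = w y x) /\
  (forall x y, A x -> A y -> 0 <= w x y).

Definition bounded_valence (A : set V) (w : V -> V -> R) : Prop :=
  (forall x, A x -> finite_set [set y | A y /\ w x y != 0]) /\
  (exists M : R, forall x, A x -> valence A w x <= M).

Definition subgraph (A : set V) (w : V -> V -> R)
    (A' : set V) (w' : V -> V -> R) : Prop :=
  [/\ A `<=` A',
      forall x y, A x -> A y -> w x y = w y x &
      forall x y, A x -> A y -> w x y = w' x y \/ w x y = 0].

(* Boundary of (A, w) seen as a subgraph of (A', w'). *)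
Definition boundary (A : set V) (w : V -> V -> R)
    (A' : set V) (w' : V -> V -> R) : set V :=
  [set x | A x /\ valence A w x < valence A' w' x].

Definition laplacian (A : set V) (w : V -> V -> R) (f : V -> R) (x : V) : R :=
  \sum_(y \in A) (f x - f y) * w x y.

(* Derivative of a function on [0, +oo[: at [t = 0] this is the right
   derivative, at [t > 0] the usual one; values at negative arguments are
   never used. *)
Definition time_derivative (f : R -> R) (t : R) : R :=
  lim (h^-1 * (f (t + h) - f t) @[h --> within [set h | 0 <= t + h] 0^']).

(* The operator L = Delta + d/dt, acting in the first variable. *)
Definition heat_operator (A : set V) (w : V -> V -> R) (H : V -> V -> R -> R)
    (v1 v2 : V) (t : R) : R :=
  laplacian A w (fun v => H v v2 t) v1 + time_derivative (H v1 v2) t.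

Definition solves_heat_at (A : set V) (w : V -> V -> R)
    (H : V -> V -> R -> R) (v1 v2 : V) : Prop :=
  forall t, 0 < t ->
    derivable (H v1 v2) t 1 /\ heat_operator A w H v1 v2 t = 0.

(* [t] ranges over [0, +oo[, with [t = 0] included. *)
Definition initial_delta_at (H : V -> V -> R -> R) (v1 v2 : V) : Prop :=
  H v1 v2 t @[t --> within [set t | 0 <= t] (nbhs (0 : R))]
    --> ((v1 == v2)%:R : R).

(* On an infinite graph, kernels are unique only within this class. *)
Definition locally_bounded_kernel (A : set V) (H : V -> V -> R -> R) : Prop :=
  forall v2, A v2 -> forall T : R, exists M : R,
    forall v1 t, A v1 -> 0 <= t <= T -> `|H v1 v2 t| <= M.

Definition is_heat_kernel (A : set V) (w : V -> V -> R)
    (H : V -> V -> R -> R) : Prop :=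
  [/\ forall v1 v2, A v1 -> A v2 -> solves_heat_at A w H v1 v2,
      forall v1 v2, A v1 -> A v2 -> initial_delta_at H v1 v2 &
      locally_bounded_kernel A H].

(* [B] is the set of vertices at which the Dirichlet condition is imposed. *)
Definition is_dirichlet_heat_kernel (A B : set V) (w : V -> V -> R)
    (H : V -> V -> R -> R) : Prop :=
  [/\ forall v1 v2, (A `\` B) v1 -> A v2 -> solves_heat_at A w H v1 v2,
      forall v1 v2, (A `\` B) v1 -> A v2 -> initial_delta_at H v1 v2,
      forall v1 v2 t, B v1 -> A v2 -> 0 <= t -> H v1 v2 t = 0 &
      locally_bounded_kernel A H].

Definition convolution (A : set V) (F1 F2 : V -> V -> R -> R)
    (v1 v2 : V) (t : R) : R :=
  (\int[lebesgue_measure]_(r in `[0, t])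
    (\sum_(v \in A) F1 v1 v (t - r) * F2 v v2 r))%R.

(* The l-fold convolution power, for l >= 1. *)
Definition convolution_power (A : set V) (f : V -> V -> R -> R) (l : nat) :
    V -> V -> R -> R :=
  iter l.-1 (fun g => convolution A g f) f.

Definition parametrix (A B : set V) (H : V -> V -> R -> R)
    (v1 v2 : V) (t : R) : R :=
  if [&& v1 \in A `\` B, v2 \in A & 0 <= t] then H v1 v2 t else 0.

Definition neumann_term (A : set V) (f : V -> V -> R -> R) (l : nat)
    (v1 v2 : V) (t : R) : R :=
  (-1) ^+ l * convolution_power A f l v1 v2 t.

Definition neumann_series (A : set V) (f : V -> V -> R -> R)
    (v1 v2 : V) (t : R) : R :=
  limn (fun n => \sum_(1 <= l < n) neumann_term A f l v1 v2 t).

Definition spacetime_domain (A : set V) : set (spacetime R V) :=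
  [set p | [/\ A p.1.1, A p.1.2 & 0 <= p.2]].

(* The series of absolute values converges uniformly on K, and the series
   itself converges uniformly on K to S. *)
Definition abs_unif_converges (K : set (spacetime R V))
    (u : nat -> V -> V -> R -> R) (S : V -> V -> R -> R) : Prop :=
  (exists S' : spacetime R V -> R,
     {uniform K, (fun (n : nat) (p : spacetime R V) =>
        \sum_(1 <= l < n) `|u l p.1.1 p.1.2 p.2|) @ \oo --> S'}) /\
  {uniform K, (fun (n : nat) (p : spacetime R V) =>
      \sum_(1 <= l < n) u l p.1.1 p.1.2 p.2) @ \oo
    --> (fun p : spacetime R V => S p.1.1 p.1.2 p.2)}.

End WeightedGraphs.

(* Main.v *)
Require Import Defs.
From mathcomp Require Import all_boot all_order all_algebra finmap.
From mathcomp Require Import all_classical all_reals all_analysis.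
From mathcomp Require Import measurable_realfun.
From mathcomp Require Import ring lra.
Import Order.TTheory GRing.Theory Num.Theory.
Import numFieldNormedType.Exports.
Local Open Scope classical_set_scope.
Local Open Scope ring_scope.

Set Implicit Arguments.
Unset Strict Implicit.

(* Put K := L H0, the error of the parametrix as a solution of the heat
   equation. K(v1, .) vanishes unless v1 lies in the finite set
   S := boundary G + boundary (G minus boundary G), so the convolutions of K
   are matrix convolutions over S, and
   |K^{*l}| <= c (#|S| c)^(l-1) t^(l-1) / (l-1)! gives the uniform convergence
   of F. As H0(., ., 0) is the identity off the
   boundary, L (H0 * F) = F + K * F, and F = - K - K * F makes
   L (H0 + H0 * F) vanish. Uniqueness is Picard iteration, the Laplacian being
   bounded. *)

(** * Convolution of functions on [0, +oo[ *)

Section HalfLineConvolution.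
Variable R : realType.
Implicit Types (f g h p q : R -> R) (t T : R).
Notation mu := (@lebesgue_measure R).

(** At a vertex x off the boundary of G no weight is lost, so L H0 differs from the heat equation of
    the big graph only through neighbours of x in the boundary, where H0 is 0 instead of the heat
    kernel; such an x lies in the boundary of the interior. The Dirichlet condition comes for free:
    H0 has zero rows on the boundary, and a convolution with F on the right keeps them zero. K may
    still be nonzero in boundary rows, so the resolvent identity has to be a matrix identity over
    all of S. The delicate point is t = 0. H0 jumps to 0 at negative times, and the integrals run
    over the closed interval from 0 to t. Regularity therefore means continuity on the closed half
    line together with derivatives at positive times, and K has to be shown continuous up to t = 0.
    F is only known to be continuous, so in H0 * F the time derivative must fall on H0; the endpoint
    of the integral then yields the term with H0 at time 0. *)

Definition cont0 f : Prop := {within `[(0 : R), +oo[, continuous f}.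

Definition cconv f g t : R :=
  (\int[mu]_(r in `[(0 : R), t]) (f (t - r) * g r))%R.

Lemma max0_continuous : continuous (fun x : R => Num.max 0 x).
Proof.
by move=> x; apply: (@continuous_max _ _ (cst 0) id); [exact: cvg_cst|exact: cvg_id].
Qed.

(** Composing with [Num.max 0] extends [f] to negative arguments by the constant [f 0]. The
    integrands become continuous on the whole line, hence integrable on segments, without changing
    on the half line. *)
Lemma cont0_max0 f : cont0 f -> continuous (fun x : R => f (Num.max 0 x)).
Proof.
move=> /subspace_continuousP cf x.
have /cf fx : `[(0 : R), +oo[%classic (Num.max 0 x).
  by rewrite /= in_itv/= andbT le_max lexx.
apply: (@cvg_comp _ _ _ (fun y : R => Num.max 0 y) f _
  (within `[(0 : R), +oo[%classic (nbhs (Num.max 0 x : R))) _ _ fx) => P /= wP.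
have : nbhs x [set y : R | `[0, +oo[%classic (Num.max 0 y) -> P (Num.max 0 y)].
  exact: (max0_continuous wP).
apply: filterS => y /=; apply.
by rewrite /= in_itv/= andbT le_max lexx.
Qed.

Lemma cont0_eq f g : (forall x, 0 <= x -> f x = g x) -> cont0 f -> cont0 g.
Proof.
move=> fg; apply: subspace_eq_continuous => x.
by rewrite inE/= in_itv/= andbT => /fg.
Qed.

Lemma cont0_cst (c : R) : cont0 (fun=> c).
Proof. by apply: continuous_subspaceT => x; exact: cvg_cst. Qed.

Lemma cont0D f g : cont0 f -> cont0 g -> cont0 (fun x => f x + g x).
Proof. by move=> cf cg x; apply: cvgD; [exact: cf|exact: cg]. Qed.

Lemma cont0M f g : cont0 f -> cont0 g -> cont0 (fun x => f x * g x).
Proof. by move=> cf cg x; apply: cvgM; [exact: cf|exact: cg]. Qed.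

Lemma cont0N f : cont0 f -> cont0 (fun x => - f x).
Proof. by move=> cf x; apply: cvgN; exact: cf. Qed.

Lemma cont0_sum (I : Type) (s : seq I) (F : I -> R -> R) :
  (forall i, cont0 (F i)) -> cont0 (fun x => \sum_(i <- s) F i x).
Proof.
move=> cF; elim: s => [|i s ih].
  by apply: (cont0_eq _ (@cont0_cst 0)) => x _; rewrite big_nil.
apply: (cont0_eq _ (cont0D (cF i) ih)).
by move=> x _; rewrite big_cons.
Qed.

Lemma cont0_sumr (I : eqType) (s : seq I) (F : I -> R -> R) :
  {in s, forall i, cont0 (F i)} -> cont0 (fun x => \sum_(i <- s) F i x).
Proof.
move=> cF; pose F' i := if i \in s then F i else cst 0.
apply: (@cont0_eq (fun x => \sum_(i <- s) F' i x)).
  by move=> x _; apply: eq_big_seq => i si; rewrite /F' si.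
apply: cont0_sum => i; rewrite /F'; case: ifPn => [/cF//|_]; exact: cont0_cst.
Qed.

Lemma cont0_bounded f T : cont0 f ->
  exists2 c, 0 <= c & forall x, 0 <= x <= T -> `|f x| <= c.
Proof.
move=> cf; have cT : {within `[0, T], continuous f}.
  apply: continuous_subspaceW cf => x /=.
  by rewrite !in_itv/= => /andP[->].
have /compact_bounded[M [_ bM]] :=
  continuous_compact cT (@segment_compact _ 0 T).
exists (`|M| + 1); first by rewrite addr_ge0.
move=> x xT; apply: (bM (`|M| + 1)); last by exists x => //=; rewrite in_itv/=.
by rewrite ltr_pwDr// ler_norm.
Qed.

Lemma eq_cconv f f' g g' t :
  (forall x, 0 <= x <= t -> f x = f' x) ->
  (forall x, 0 <= x <= t -> g x = g' x) -> cconv f g t = cconv f' g' t.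
Proof.
move=> ff gg; apply: eq_Rintegral => r; rewrite inE/= in_itv/= => /andP[r0 rt].
by rewrite ff ?gg ?r0 ?rt// subr_ge0 rt lerBlDr lerDl r0.
Qed.

Lemma integrable_continuous (a b : R) f : continuous f ->
  mu.-integrable `[a, b] (EFin \o f).
Proof.
move=> cf; apply: continuous_compact_integrable; first exact: segment_compact.
exact: continuous_subspaceT.
Qed.

Lemma cconv_continuous_integrand f g t : cont0 f -> cont0 g ->
  continuous (fun r : R => f (Num.max 0 (t - r)) * g (Num.max 0 r)).
Proof.
move=> /cont0_max0 cf /cont0_max0 cg r; apply: cvgM; last exact: cg.
apply: (@continuous_comp _ _ _ (fun r : R => t - r)
  (fun x : R => f (Num.max 0 x))); last exact: cf.
by apply: cvgB; [exact: cvg_cst|exact: cvg_id].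
Qed.

Lemma cconv_integrable f g t : cont0 f -> cont0 g ->
  mu.-integrable `[0, t] (EFin \o (fun r => f (t - r) * g r)).
Proof.
move=> cf cg.
apply: eq_integrable (integrable_continuous 0 t
  (cconv_continuous_integrand (t := t) cf cg)) => //.
move=> r; rewrite inE/= in_itv/= => /andP[r0 rt].
by rewrite !max_r// subr_ge0.
Qed.

Lemma cconv_0 f g : cconv f g 0 = 0.
Proof. by rewrite /cconv set_itv1 Rintegral_set1. Qed.

Lemma cconvDl f f' g t : cont0 f -> cont0 f' -> cont0 g ->
  cconv (fun x => f x + f' x) g t = cconv f g t + cconv f' g t.
Proof.
move=> cf cf' cg; rewrite /cconv.
under eq_Rintegral do rewrite mulrDl.
by rewrite RintegralD//; exact: cconv_integrable.
Qed.

Lemma cconvDr f g g' t : cont0 f -> cont0 g -> cont0 g' ->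
  cconv f (fun x => g x + g' x) t = cconv f g t + cconv f g' t.
Proof.
move=> cf cg cg'; rewrite /cconv.
under eq_Rintegral do rewrite mulrDr.
by rewrite RintegralD//; exact: cconv_integrable.
Qed.

Lemma cconvZl (c : R) f g t : cont0 f -> cont0 g ->
  cconv (fun x => c * f x) g t = c * cconv f g t.
Proof.
move=> cf cg; rewrite /cconv.
under eq_Rintegral do rewrite -mulrA.
by rewrite RintegralZl//; exact: cconv_integrable.
Qed.

Lemma cconvZr (c : R) f g t : cont0 f -> cont0 g ->
  cconv f (fun x => c * g x) t = c * cconv f g t.
Proof.
move=> cf cg; rewrite /cconv.
under eq_Rintegral do rewrite mulrCA.
by rewrite RintegralZl//; exact: cconv_integrable.
Qed.

Lemma cconv0l g t : cconv (fun=> 0) g t = 0.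
Proof.
rewrite /cconv; under eq_Rintegral do rewrite mul0r.
by rewrite Rintegral_cst ?mul0r.
Qed.

Lemma cconv0r f t : cconv f (fun=> 0) t = 0.
Proof.
rewrite /cconv; under eq_Rintegral do rewrite mulr0.
by rewrite Rintegral_cst ?mul0r.
Qed.

Lemma cconv_suml (I : eqType) (s : seq I) (F : I -> R -> R) g t :
  {in s, forall i, cont0 (F i)} -> cont0 g ->
  cconv (fun x => \sum_(i <- s) F i x) g t = \sum_(i <- s) cconv (F i) g t.
Proof.
elim: s => [|i s ih] cF cg.
  rewrite big_nil -[RHS](cconv0l g t).
  by apply: eq_cconv => // x _; rewrite big_nil.
have cFs : {in s, forall i, cont0 (F i)}.
  by move=> j js; apply: cF; rewrite inE js orbT.
rewrite big_cons -ih// -cconvDl//.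
- by apply: eq_cconv => // x _; rewrite big_cons.
- by apply: cF; rewrite inE eqxx.
- exact: cont0_sumr.
Qed.

Lemma cconv_sumr (I : eqType) (s : seq I) (F : I -> R -> R) f t :
  {in s, forall i, cont0 (F i)} -> cont0 f ->
  cconv f (fun x => \sum_(i <- s) F i x) t = \sum_(i <- s) cconv f (F i) t.
Proof.
elim: s => [|i s ih] cF cf.
  rewrite big_nil -[RHS](cconv0r f t).
  by apply: eq_cconv => // x _; rewrite big_nil.
have cFs : {in s, forall i, cont0 (F i)}.
  by move=> j js; apply: cF; rewrite inE js orbT.
rewrite big_cons -ih// -cconvDr//.
- by apply: eq_cconv => // x _; rewrite big_cons.
- by apply: cF; rewrite inE eqxx.
- exact: cont0_sumr.
Qed.

Lemma integral_subX n t : 0 <= t ->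
  (\int[mu]_(r in `[(0 : R), t]) ((t - r) ^+ n))%R = t ^+ n.+1 / n.+1%:R.
Proof.
rewrite le_eqVlt => /predU1P[<-|t0].
  by rewrite set_itv1 Rintegral_set1 expr0n mul0r.
pose P (r : R) := - ((t - r) ^+ n.+1 / n.+1%:R).
have dP (r : R) : is_derive r 1 P ((t - r) ^+ n).
  have n0 : n.+1%:R != 0 :> R by rewrite pnatr_eq0.
  have -> : P = - n.+1%:R^-1 *: ((cst t - id) ^+ n.+1).
    by apply/funext => y; rewrite /P mulrC -mulNr exprfctE.
  apply: is_derive_eq; rewrite /GRing.scale/= !fctE/=.
  by rewrite sub0r; field.
rewrite /Rintegral (@continuous_FTC2 _ _ P)//.
- by rewrite -EFinB /= /P subrr expr0n/= mul0r oppr0 sub0r opprK addr0.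
- apply: continuous_subspaceT => r.
  apply: (@continuous_comp _ _ _ (fun r : R => t - r) (fun x : R => x ^+ n)).
    by apply: cvgB; [exact: cvg_cst|exact: cvg_id].
  exact: exprn_continuous.
- have cP : continuous P.
    move=> r; apply: differentiable_continuous.
    by apply/derivable1_diffP; case: (dP r).
  split => //.
  + exact/cvg_at_right_filter/cP.
  + exact/cvg_at_left_filter/cP.
- by move=> r _; rewrite derive1E; case: (dP r).
Qed.

(** Only the left factor carries a power of time. One convolution raises this power by one and
    divides by [n.+1], which is where the factorials in the bounds come from. *)
Lemma cconv_bound (a c : R) n f g t : cont0 f -> cont0 g -> 0 <= t -> 0 <= a ->
  (forall x, 0 <= x <= t -> `|f x| <= a * x ^+ n) ->
  (forall x, 0 <= x <= t -> `|g x| <= c) ->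
  `|cconv f g t| <= a * c * (t ^+ n.+1 / n.+1%:R).
Proof.
move=> cf cg t0 a0 bf bg.
have ci : continuous (fun r : R => (t - r) ^+ n).
  move=> r; apply: (@continuous_comp _ _ _ (fun r : R => t - r) (fun x : R => x ^+ n)).
    by apply: cvgB; [exact: cvg_cst|exact: cvg_id].
  exact: exprn_continuous.
apply: (le_trans (le_normr_Rintegral _ (cconv_integrable t cf cg))) => //.
rewrite -integral_subX// -RintegralZl//; last exact: integrable_continuous.
apply: le_Rintegral => //.
- by have := cconv_integrable t cf cg => /integrable_norm.
- apply: integrable_continuous => r; apply: cvgM; [exact: cvg_cst|exact: ci].
- move=> r; rewrite /= in_itv/= => /andP[r0 rt].
  rewrite normrM mulrAC ler_pM// ?bf ?bg ?r0//.
  by rewrite subr_ge0 rt lerBlDr lerDl.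
Qed.

End HalfLineConvolution.

(** * Continuity of the convolution in time, and primitives on the half line *)

Section ConvolutionContinuity.
Variable R : realType.
Implicit Types (f g h p q : R -> R) (t T : R).
Notation mu := (@lebesgue_measure R).

Lemma cont0_segments f :
  (forall T, 0 < T -> {within `[0, T], continuous f}) -> cont0 f.
Proof.
move=> cf; apply/continuous_within_itvcyP; split.
  move=> x; rewrite in_itv/= andbT => x0.
  apply: (@within_continuous_continuous _ _ _ 0 (x + 1)).
  - by rewrite ltr_wpDl// ltW.
  - by apply: cf; rewrite ltr_wpDl// ltW.
  - by rewrite in_itv/= x0 ltrDl ltr01.
by have /(continuous_within_itvP _ ltr01)[] := cf 1 ltr01.
Qed.

Lemma cont0_integrable f T : cont0 f -> mu.-integrable `[0, T] (EFin \o f).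
Proof.
move=> cf.
apply: eq_integrable (integrable_continuous 0 T (cont0_max0 cf)) => //.
by move=> r; rewrite inE/= in_itv/= => /andP[r0 _]; rewrite max_r.
Qed.

Lemma primitive_derive g t : cont0 g -> 0 < t ->
  is_derive t 1 (fun t => \int[mu]_(r in `[(0 : R), t]) g r)%R (g t).
Proof.
move=> cg t0.
have tt1 : t < t + 1 by rewrite ltrDl.
have /continuous_within_itvcyP[cgi _] := cg.
have [|] := continuous_FTC1_closed tt1 (cont0_integrable (t + 1) cg) t0.
  by apply: cgi; rewrite in_itv/= t0.
by move=> d e; apply: DeriveDef => //; rewrite -derive1E.
Qed.

(** The derivative is asked for at positive times only, and continuity of [p] covers the endpoint 0.
    This is the form in which the heat equation is available. *)
Lemma primitive_FTC2 p q t : cont0 p -> cont0 q ->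
  (forall s : R, 0 < s -> is_derive s 1 p (q s)) -> 0 <= t ->
  p t = p 0 + (\int[mu]_(r in `[(0 : R), t]) q r)%R.
Proof.
move=> cp cq dp; rewrite le_eqVlt => /predU1P[<-|t0].
  by rewrite set_itv1 Rintegral_set1 addr0.
rewrite /Rintegral (@continuous_FTC2 _ q p)//.
- by rewrite -EFinB /= addrC subrK.
- by apply: continuous_subspaceW cq => x /=; rewrite !in_itv/= => /andP[->].
- have /(continuous_within_itvP _ t0)[_ c0 ct] : {within `[0, t], continuous p}.
    by apply: continuous_subspaceW cp => x /=; rewrite !in_itv/= => /andP[->].
  split => // s; rewrite in_itv/= => /andP[s0 _]; by case: (dp s s0).
- move=> s; rewrite in_itv/= => /andP[s0 _]; rewrite derive1E.
  by case: (dp s s0).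
Qed.

Lemma cconv_cont0 f g : cont0 f -> cont0 g -> cont0 (cconv f g).
Proof.
move=> cf cg.
(* Once f 0 is subtracted, f (t - r) extends continuously by 0 to r > t, and
   the range of integration no longer depends on t. *)
pose h x := f (Num.max 0 x) - f 0; pose G r := g (Num.max 0 r).
have ch : continuous h.
  by move=> x; apply: cvgB; [exact: cont0_max0|exact: cvg_cst].
have cG : continuous G by exact: cont0_max0.
have csub l : continuous (fun r : R => l - r).
  by move=> r; apply: cvgB; [exact: cvg_cst|exact: cvg_id].
have cint l : continuous (fun r => h (l - r) * G r).
  move=> r; apply: cvgM; last exact: cG.
  by apply: (@continuous_comp _ _ _ (fun r : R => l - r) h);
    [exact: csub|exact: ch].
apply: cont0_segments => T T0.
(* The parameter ranges over an open interval around [[0, T]]. There [l - r] stays below [T + 1], so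
   [c] bounds both values of [f] in [h], and the constant [(c + c) * d] dominates the integrand. *)
have cPhi : {in `]-1, T + 1[%classic, continuous (fun l =>
     \int[mu]_(r in `[0%R, T]) (h (l - r) * G r))%R}.
  have [c c0 bf] := cont0_bounded (T + 1) cf.
  have [d d0 bg] := cont0_bounded T cg.
  apply: (@continuity_under_integral R _ _ mu (fun l r => h (l - r) * G r)
    `[0, T]%classic _ (-1) (T + 1) _ _ (cst ((c + c) * d))) => //.
  - by move=> l _; exact: integrable_continuous.
  - apply: aeW => r _ l _; apply: cvgM; last exact: cvg_cst.
    apply: (@continuous_comp _ _ _ (fun l : R => l - r) h); last exact: ch.
    by apply: cvgB; [exact: cvg_id|exact: cvg_cst].
  - by apply: integrable_continuous => x; exact: cvg_cst.
  - move=> l; rewrite /= in_itv/= => /andP[l1 lT]; apply: aeW => r /=.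
    rewrite in_itv/= => /andP[r0 rT].
    rewrite normrM ler_pM//.
      rewrite /h (le_trans (ler_normB _ _))// lerD// bf ?lexx//=; last by lra.
      by rewrite le_max lexx ge_max/=; apply/andP; split; lra.
    by rewrite /G bg// max_r// r0.
apply: (@subspace_eq_continuous _ _ _ (fun t =>
    f 0 * (\int[mu]_(r in `[(0 : R), t]) g r)
    + \int[mu]_(r in `[0%R, T]) (h (t - r) * G r))%R).
  move=> t; rewrite inE/= in_itv/= => /andP[t0 tT].
  have -> : (\int[mu]_(r in `[0%R, T]) (h (t - r) * G r) =
             \int[mu]_(r in `[0%R, t]) (h (t - r) * G r))%R.
    rewrite [in RHS](_ : `[0, t]%classic = `[0, T] `&` `[0, t]); last first.
      by apply/esym/setIidPr => x /=; rewrite !in_itv/= => /andP[->] /le_trans; apply.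
    rewrite Rintegral_mkcondr; apply: eq_Rintegral => r.
    rewrite inE/= in_itv/= => /andP[r0 rT].
    rewrite /patch; case: ifPn => //; rewrite notin_setE/= in_itv/= r0/= => /negP.
    by rewrite -ltNge => tr; rewrite /h max_l ?subrr ?mul0r// subr_le0 ltW.
  rewrite -RintegralZl//; last exact: cont0_integrable.
  rewrite -RintegralD//; first last.
  - exact: integrable_continuous.
  - exact: cont0_integrable t (cont0M (@cont0_cst R (f 0)) cg).
  apply: eq_Rintegral => r; rewrite inE/= in_itv/= => /andP[r0 rt].
  rewrite /h /G !max_r ?subr_ge0//; ring.
move=> x; apply: cvgD.
  apply: cvgM; first exact: cvg_cst.
  exact: parameterized_integral_continuous (ltW T0) (cont0_integrable T cg) x.
have : {within `[0, T], continuous (fun l =>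
    \int[mu]_(r in `[0%R, T]) (h (l - r) * G r))%R}.
  apply: continuous_in_subspaceT => l; rewrite inE/= in_itv/= => /andP[l0 lT].
  by apply: cPhi; rewrite inE /= in_itv/=; apply/andP; split; lra.
exact.
Qed.

End ConvolutionContinuity.

(** * Associativity of the convolution, and its time derivative *)

Section ConvolutionAssociativity.
Variable R : realType.
Implicit Types (f g h p q : R -> R) (t T : R).
Notation mu := (@lebesgue_measure R).

(* Not R * R: the product measure is taken over the domain of
   lebesgue_measure, whose measurable structure has another display. *)
Local Notation RR := (measurableTypeR R).

(** Fubini on the triangle 0 <= s <= r <= t: cutting [k] off outside the triangle turns the moving
    bounds of both iterated integrals into integrals over the whole plane. *)
Lemma Rintegral_triangle (k : RR * RR -> R) t c :
  measurable_fun [set: RR * RR] k -> (forall z, `|k z| <= c) ->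
  (\int[mu]_(r in `[0%R, t]) \int[mu]_(s in `[0%R, r]) k (r, s) =
   \int[mu]_(s in `[0%R, t]) \int[mu]_(r in `[s, t]) k (r, s))%R.
Proof.
move=> mk bk.
pose D : set (RR * RR) := [set z | [/\ 0 <= z.2, z.2 <= z.1 & z.1 <= t]].
have mD : measurable D.
  rewrite (_ : D = (snd @^-1` `[0, +oo[) `&`
      ((fun z : RR * RR => z.1 - z.2) @^-1` `[0, +oo[) `&` (fst @^-1` `]-oo, t])).
    apply: measurableI; first apply: measurableI.
    - by rewrite -[X in measurable X]setTI; exact: measurable_snd.
    - rewrite -[X in measurable X]setTI; apply: measurable_funB => //.
    - by rewrite -[X in measurable X]setTI; exact: measurable_fst.
  apply/seteqP; split=> [z [z0 z21 zt]|z /= [[]]] /=; rewrite !in_itv/= ?andbT.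
    by rewrite subr_ge0.
  by rewrite subr_ge0.
pose kD := k \_ D.
have mkD : measurable_fun [set: RR * RR] kD.
  by apply/(measurable_restrictT _ _).1 => //; exact: measurable_funTS.
have bkD : [bounded kD z | z in [set: RR * RR]].
  exists `|c|; split; first exact: num_real.
  move=> M cM z _ /=; rewrite /kD /patch; case: ifPn => _.
    by rewrite (le_trans (bk z))// (le_trans _ (ltW cM))// ler_norm.
  by rewrite normr0 (le_trans _ (ltW cM)).
have ikD : (mu \x mu)%E.-integrable [set: RR * RR] (EFin \o kD).
  rewrite /kD -restrict_EFin; apply: (iffLR (integrable_mkcond _ mD)).
  apply: measurable_bounded_integrable => //.
  - have mI := @measurable_itv R `[0, t].
    apply: (@le_lt_trans _ _ ((mu \x mu)%E (`[0, t]%classic `*` `[0, t]%classic))).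
      apply: le_measure; rewrite ?inE//; first exact: measurableX.
      move=> z [z0 z21 zt]; split; rewrite /= in_itv/=.
        by rewrite (le_trans z0 z21).
      by rewrite z0 (le_trans z21 zt).
    rewrite product_measure1E//; apply: lte_mul_pinfty => //.
    + by rewrite /= lebesgue_measure_itv/=; case: ifP.
    + by rewrite /= lebesgue_measure_itv/=; case: ifP => // _; rewrite -EFinB ltry.
  - exact: measurable_funTS.
  - exists `|c|; split; first exact: num_real.
    move=> M cM z _ /=.
    by rewrite (le_trans (bk z))// (le_trans _ (ltW cM))// ler_norm.
(* The way back from extended-real integrals of cut-off functions over the line to real integrals
   over intervals. *)
have intE (phi : R -> R) (a b : R) : measurable_fun [set: R] phi ->
    (forall r, `|phi r| <= c) ->
    (\int[mu]_r ((phi \_ `[a, b]) r)%:E =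
     ((\int[mu]_(r in `[a, b]) phi r)%R)%:E)%E.
  move=> mphi bphi.
  have iphi : mu.-integrable `[a, b] (EFin \o phi).
    apply: measurable_bounded_integrable => //.
    + by rewrite /= lebesgue_measure_itv/=; case: ifP => // _; rewrite -EFinB ltry.
    + exact: measurable_funTS.
    + exists `|c|; split; first exact: num_real.
      move=> M cM z _ /=.
      by rewrite (le_trans (bphi z))// (le_trans _ (ltW cM))// ler_norm.
  rewrite /Rintegral fineK; last exact: integrable_fin_num.
  rewrite [in RHS]integral_mkcond; apply: eq_integral => r _.
  by rewrite /patch; case: ifP.
have := Fubini ikD => /=.
under eq_integral => r _.
  rewrite (_ : (\int[mu]_y _)%E =
    (((fun r => (\int[mu]_(s in `[0%R, r]) k (r, s))%R) \_ `[0, t]) r)%:E).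
    over.
  rewrite /patch; case: ifPn => [|]; rewrite ?inE ?notin_setE/= in_itv/=.
    move=> /andP[r0 rt]; rewrite -intE//; last exact: measurableT_comp.
    apply: eq_integral => s _; congr EFin; rewrite /kD /patch.
    congr (if _ then _ else _); apply/idP/idP; rewrite !inE/= in_itv/=.
      by case=> /= -> ->.
    by move=> /andP[s0 sr]; split.
  move=> rt; rewrite integral0_eq// => s _; rewrite /kD /patch ifN// notin_setE.
  by move=> [/= s0 sr srt]; apply: rt; rewrite srt (le_trans s0 sr).
under [in RHS]eq_integral => s _.
  rewrite (_ : (\int[mu]_y _)%E =
    (((fun s => (\int[mu]_(r in `[s, t]) k (r, s))%R) \_ `[0, t]) s)%:E).
    over.
  rewrite /patch; case: ifPn => [|]; rewrite ?inE ?notin_setE/= in_itv/=.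
    move=> /andP[s0 st]; rewrite -(intE (fun r => k (r, s)))//;
      last exact: measurableT_comp.
    apply: eq_integral => r _; congr EFin; rewrite /kD /patch.
    congr (if _ then _ else _); apply/idP/idP; rewrite !inE/= in_itv/=.
      by case=> /= _ -> ->.
    by move=> /andP[sr rt]; split.
  move=> st; rewrite integral0_eq// => r _; rewrite /kD /patch ifN// notin_setE.
  by move=> [/= s0 sr srt]; apply: st; rewrite s0 (le_trans sr srt).
by move=> /(congr1 fine) e; rewrite Rintegral_mkcond [RHS]Rintegral_mkcond.
Qed.

Lemma Rintegral_translate f (s t : R) : continuous f -> s <= t ->
  (\int[mu]_(r in `[s, t]) f (r - s) = \int[mu]_(r in `[0%R, t - s]) f r)%R.
Proof.
move=> cf st.
have dF (x : R) : is_derive x 1 (fun r : R => r - s) (1 - 0) by exact: is_deriveB.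
have F1 : derive1 (fun r : R => r - s) = cst 1.
  by apply/funext => x; rewrite derive1E derive_val subr0.
rewrite /Rintegral -[X in `[X, t - s]](subrr s).
rewrite (@integration_by_substitution_increasing _ (fun r => r - s) f)//.
- by congr fine; apply: eq_integral => r _ /=; rewrite F1 /= mulr1.
- by move=> x y _ _ xy; rewrite ltrD2r.
- by rewrite F1 => x _; exact: cvg_cst.
- by rewrite F1; exact: is_cvg_cst.
- by rewrite F1; exact: is_cvg_cst.
- have c x : {for x, continuous (fun r : R => r - s)}.
    by apply: cvgB; [exact: cvg_id|exact: cvg_cst].
  split=> //; [exact/cvg_at_right_filter/c|exact/cvg_at_left_filter/c].
- exact: continuous_subspaceT.
Qed.

(** After the translation of the inner variable by s, both sides are iterated integrals of f(t - r)
    g(r - s) h(s) over the same triangle, in opposite orders. *)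
Lemma cconvA f g h t : cont0 f -> cont0 g -> cont0 h -> 0 <= t ->
  cconv (cconv f g) h t = cconv f (cconv g h) t.
Proof.
move=> cf cg ch t0.
have [b b0 bf] := cont0_bounded t cf.
have [c c0 bg] := cont0_bounded t cg.
have [d d0 bh] := cont0_bounded t ch.
(* Clamping the argument to [[0, t]] makes the three factors continuous and bounded on the whole
   line, so that their product is measurable and bounded on the plane. On the triangle all arguments
   lie in [[0, t]], where the clamp is the identity. *)
pose E (u : R -> R) (x : R) := u (Num.max 0 (Num.min t x)).
have EE u x : 0 <= x <= t -> E u x = u x.
  by move=> /andP[x0 xt]; rewrite /E min_r// max_r.
have Ebnd x : 0 <= Num.max 0 (Num.min t x) <= t.
  by rewrite le_max lexx/= ge_max t0 ge_min lexx.
have cE u : cont0 u -> continuous (E u).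
  move=> /cont0_max0 cu x.
  apply: (@continuous_comp _ _ _ (fun x : R => Num.min t x)
    (fun x : R => u (Num.max 0 x))); last exact: cu.
  by apply: (@continuous_min _ _ (cst t) id); [exact: cvg_cst|exact: cvg_id].
have mE u : cont0 u -> measurable_fun [set: R] (E u).
  by move=> /cE; exact: continuous_measurable_fun.
pose k (z : RR * RR) := E f (t - z.1) * (E g (z.1 - z.2) * E h z.2).
have mk : measurable_fun [set: RR * RR] k.
  apply: measurable_funM; last apply: measurable_funM.
  - apply: (@measurableT_comp _ _ _ _ _ _ (E f)); first exact: mE.
    by apply: measurable_funB.
  - apply: (@measurableT_comp _ _ _ _ _ _ (E g)); first exact: mE.
    by apply: measurable_funB.
  - by apply: (@measurableT_comp _ _ _ _ _ _ (E h)); first exact: mE.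
have bk z : `|k z| <= b * (c * d).
  by rewrite /k !normrM !ler_pM// ?bf ?bg ?bh// Ebnd.
transitivity (\int[mu]_(s in `[0%R, t]) \int[mu]_(r in `[s, t]) k (r, s))%R.
  apply: eq_Rintegral => s; rewrite inE/= in_itv/= => /andP[s0 st].
  have cfg : continuous (fun r => E f (t - s - r) * E g r).
    move=> r; apply: cvgM; last exact: cE.
    apply: (@continuous_comp _ _ _ (fun r : R => t - s - r) (E f)); last exact: cE.
    by apply: cvgB; [exact: cvg_cst|exact: cvg_id].
  transitivity ((\int[mu]_(r in `[0%R, t - s]) (E f (t - s - r) * E g r))%R * h s).
    congr (_ * _); apply: eq_Rintegral => r.
    rewrite inE/= in_itv/= => /andP[r0 rt].
    rewrite !EE// ?r0/=; lra.
  rewrite -Rintegral_translate// -RintegralZr//; first last.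
    apply: integrable_continuous => r.
    apply: (@continuous_comp _ _ _ (fun r : R => r - s)
      (fun r => E f (t - s - r) * E g r)); last exact: cfg.
    by apply: cvgB; [exact: cvg_id|exact: cvg_cst].
  apply: eq_Rintegral => r _; rewrite /k/= (EE h) ?s0//.
  by rewrite -mulrA; congr (E f _ * _); ring.
rewrite -(Rintegral_triangle t mk bk).
apply: eq_Rintegral => r; rewrite inE/= in_itv/= => /andP[r0 rt].
transitivity (f (t - r) * (\int[mu]_(s in `[0%R, r]) (E g (r - s) * E h s))%R).
  rewrite -RintegralZl//; first last.
    apply: integrable_continuous => s; apply: cvgM; last exact: cE.
    apply: (@continuous_comp _ _ _ (fun s : R => r - s) (E g)); last exact: cE.
    by apply: cvgB; [exact: cvg_cst|exact: cvg_id].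
  by apply: eq_Rintegral => s _; rewrite /k/= (EE f)//; lra.
congr (_ * _); apply: eq_Rintegral => s; rewrite inE/= in_itv/= => /andP[s0 sr].
by rewrite !EE//; lra.
Qed.

(* Since p = p 0 + 1 * p' (convolution with the constant 1), associativity
   turns p * q into a primitive. *)
Lemma cconv_primitive p p' q t : cont0 p -> cont0 p' -> cont0 q ->
  (forall s : R, 0 < s -> is_derive s 1 p (p' s)) -> 0 <= t ->
  cconv p q t =
  (\int[mu]_(r in `[0%R, t]) (p 0 * q r + cconv p' q r))%R.
Proof.
move=> cp cp' cq dp t0.
have c1 : cont0 (fun=> 1 : R) by exact: cont0_cst.
have pE x : 0 <= x <= t -> p x = p 0 * 1 + cconv (fun=> 1) p' x.
  move=> /andP[x0 _]; rewrite (primitive_FTC2 cp cp' dp x0) mulr1.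
  by congr (_ + _); apply: eq_Rintegral => r _; rewrite mul1r.
rewrite (eq_cconv pE (fun _ _ => erefl)) cconvDl//; last 2 first.
- exact: cont0_cst.
- exact: cconv_cont0.
rewrite cconvZl// cconvA// -cconvZr// -cconvDr//; last 2 first.
- by apply: cont0M => //; exact: cont0_cst.
- exact: cconv_cont0.
by apply: eq_Rintegral => r _; rewrite mul1r.
Qed.

(** Leibniz rule, obtained by differentiating a primitive and not under the integral sign. The
    derivative falls on the left factor, [q] being only continuous; [p 0 * q t] is the contribution
    of the moving endpoint. *)
Lemma cconv_derive p p' q t : cont0 p -> cont0 p' -> cont0 q ->
  (forall s : R, 0 < s -> is_derive s 1 p (p' s)) -> 0 < t ->
  is_derive t 1 (cconv p q) (p 0 * q t + cconv p' q t).
Proof.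
move=> cp cp' cq dp t0.
have cg : cont0 (fun r => p 0 * q r + cconv p' q r).
  apply: cont0D; last exact: cconv_cont0.
  by apply: cont0M => //; exact: cont0_cst.
apply: near_eq_is_derive (primitive_derive cg t0).
near=> s; rewrite (cconv_primitive cp cp' cq dp)//.
by apply/ltW; near: s; exact: lt_nbhsr.
Unshelve. all: end_near. Qed.

End ConvolutionAssociativity.

(** * Uniform convergence of series *)

Section UniformConvergence.
Variable R : realType.

Lemma uniform_of_dist (T : choiceType) (D : set T) (f : nat -> T -> R)
    (g : T -> R) (eps : nat -> R) :
  eps @ \oo --> 0 -> (forall n p, D p -> `|g p - f n p| <= eps n) ->
  {uniform D, f @ \oo --> g}.
Proof.
move=> eps0 dist P /uniform_nbhs[E [entE subP]].
move: entE; rewrite -entourage_from_ballE => -[e /= e0 ballE].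
move/cvgrPdist_lt : eps0 => /(_ _ e0)[N _ HN].
exists N => // n /= Nn; apply: subP => p Dp; apply: ballE => /=.
rewrite /ball/= (le_lt_trans (dist n p Dp))// (le_lt_trans (ler_norm _))//.
by have := HN n Nn; rewrite sub0r normrN.
Qed.

(** The rate [eps] is the tail of the majorant series and is common to all points. Uniform
    convergence, continuity of the sum and the limit in the resolvent identity are all drawn from
    it. *)
Lemma weierstrass_test (T : Type) (D : set T) (u : nat -> T -> R)
    (b : nat -> R) :
  cvgn (series b) -> (forall n p, D p -> `|u n p| <= b n) ->
  exists2 eps : nat -> R, eps @ \oo --> 0 &
    forall p, D p -> cvgn (series (u ^~ p)) /\
      forall n, `|limn (series (u ^~ p)) - series (u ^~ p) n| <= eps n.
Proof.
move=> cb ub; exists (fun n => limn (series b) - series b n).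
  by rewrite -(subrr (limn (series b))); apply: cvgB => //; exact: cvg_cst.
move=> p Dp.
have cu : cvgn (series (u ^~ p)).
  apply: normed_cvg; apply: series_le_cvg cb => [n|n|]; first by exact: normr_ge0.
  - by apply: (le_trans _ (ub n p Dp)).
  - by move=> n; exact: ub.
split=> // n.
have cun : `|series (u ^~ p) m - series (u ^~ p) n| @[m --> \oo] -->
    `|limn (series (u ^~ p)) - series (u ^~ p) n|.
  by apply: cvg_norm; apply: cvgB => //; exact: cvg_cst.
have cbn : series b m - series b n @[m --> \oo] --> limn (series b) - series b n.
  by apply: cvgB => //; exact: cvg_cst.
apply: ler_cvg_to cun cbn _.
exists n => // m /= nm; rewrite !sub_series_geq//.
by rewrite (le_trans (ler_norm_sum _ _ _))// ler_sum// => i _; exact: ub.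
Qed.

End UniformConvergence.

(** * Compact subsets of spacetime, and bounds over finite lists *)

Lemma compact_discrete_finite (V : choiceType) (K : set (discrete_topology V)) :
  compact K -> finite_set K.
Proof.
apply: contraPP => Kinf cK.
(* The sets that miss only finitely many points of [K]. For infinite [K] this filter is proper, but
   no p is a cluster point: the complement of p belongs to it, and the singleton p is a
   neighbourhood of p. *)
pose F : set_system (discrete_topology V) := [set B | finite_set (K `\` B)].
have FF : ProperFilter F.
  split; first by rewrite /F/= setD0.
  split.
  - by rewrite /F/= setDT.
  - by move=> P Q FP FQ; rewrite /F/= setDIr finite_setU.
  - by move=> P Q PQ FP; apply: sub_finite_set FP => x [Kx nQ]; split=> // /PQ.
have [|p [_ clp]] := cK F FF; first by rewrite /F/= setDv.
have FB : F (~` [set p]).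
  by apply: (sub_finite_set _ (finite_set1 p)) => x [_ /=]; exact: contrapT.
have np : nbhs p [set p] by rewrite nbhs_principalE; exact/principal_filterP.
by have [x [/=]] := clp _ _ FB np.
Qed.

(** The first vertex is left free, because the estimates on the series are uniform in the row; only
    finitely many columns and a time horizon have to be extracted. *)
Lemma compact_spacetime (R : realType) (V : choiceType)
    (K : set (spacetime R V)) :
  compact K -> exists (ys : seq V) (T : R),
    forall p, K p -> p.1.2 \in ys /\ p.2 <= T.
Proof.
move=> cK.
have /compact_discrete_finite/finite_seqP[ys ysE] :
    compact ((fun p : spacetime R V => p.1.2) @` K).
  apply: continuous_compact cK; apply: continuous_subspaceT => p.
  by apply: (@cvg_comp _ _ _ fst snd); [exact: cvg_fst|exact: cvg_snd].
have /compact_bounded[M [_ bM]] :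
    compact ((fun p : spacetime R V => p.2) @` K).
  by apply: continuous_compact cK; apply: continuous_subspaceT => p; exact: cvg_snd.
exists ys, (`|M| + 1) => p Kp; split.
  suff : [set` ys] p.1.2 by [].
  by rewrite -ysE; exists p.
apply: (le_trans (ler_norm _)); apply: (bM (`|M| + 1)); last by exists p.
by rewrite ltr_pwDr// ler_norm.
Qed.

Lemma finite_uniform_bound (R : realType) (I : eqType) (s : seq I)
    (P : I -> R -> Prop) :
  (forall i c d, P i c -> c <= d -> P i d) ->
  (forall i, i \in s -> exists c, P i c) ->
  exists2 c, 0 <= c & forall i, i \in s -> P i c.
Proof.
move=> Pmono; elim: s => [|i s ih] Ps; first by exists 0.
have [|c c0 cs] := ih; first by move=> j js; apply: Ps; rewrite inE js orbT.
have [d Pd] := Ps i (mem_head _ _).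
exists (Num.max c d); first by rewrite le_max c0.
move=> j; rewrite inE => /predU1P[->|/cs Pc].
  by apply: Pmono Pd _; rewrite le_max lexx orbT.
by apply: Pmono Pc _; rewrite le_max lexx.
Qed.

(** * The Neumann series of a kernel with finitely many nonzero rows *)

Section Volterra.
Variables (R : realType) (V : choiceType) (A : set V) (s : seq V).
Notation mu := (@lebesgue_measure R).
Hypotheses (s_uniq : uniq s) (sA : forall v, v \in s -> A v).
Implicit Types (P Q S : V -> V -> R -> R).

Definition mconv P Q (x y : V) (t : R) : R :=
  \sum_(v <- s) cconv (P x v) (Q v y) t.

Definition cont0_kernel P := forall x y, A x -> A y -> cont0 (P x y).

Definition rows_in P := forall x y t, A x -> x \notin s -> A y -> 0 <= t ->
  P x y t = 0.

(** The summation index is a row of the right factor, so only [Q] needs its rows in [s]. The lemma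
    thus covers powers of the kernel as well as H0 * F, where H0 may have infinitely many nonzero
    rows. *)
Lemma convolution_mconv P Q x y t : cont0_kernel P -> cont0_kernel Q ->
  rows_in Q -> A x -> A y -> 0 <= t ->
  convolution A P Q x y t = mconv P Q x y t.
Proof.
move=> cP cQ rQ Ax Ay t0.
transitivity (\int[mu]_(r in `[0%R, t])
    (\sum_(v <- s) P x v (t - r) * Q v y r))%R.
  apply: eq_Rintegral => r; rewrite inE/= in_itv/= => /andP[r0 rt].
  rewrite (fsbigE s)//; last first.
    by move=> v Av vs; rewrite rQ ?mulr0.
  rewrite big_seq_cond [RHS]big_seq; apply: eq_bigl => v.
  by rewrite andb_idr// => /sA /mem_set.
rewrite /mconv.
have : {in s, forall v, A v} by [].
elim: s => [|v l ih] lA.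
  rewrite big_nil; under eq_Rintegral do rewrite big_nil.
  by rewrite Rintegral_cst ?mul0r.
have Av : A v by apply: lA; rewrite mem_head.
have lA' : {in l, forall v, A v} by move=> u ul; apply: lA; rewrite inE ul orbT.
rewrite big_cons -ih//; under eq_Rintegral do rewrite big_cons.
rewrite RintegralD//; first by apply: cconv_integrable; [exact: cP|exact: cQ].
rewrite (_ : EFin \o _ =
    (fun r => \sum_(u <- l | u \in l) (P x u (t - r) * Q u y r)%:E)%E).
  apply: integrable_sum => // u /lA' Au.
  by apply: cconv_integrable; [exact: cP|exact: cQ].
by apply/funext => r /=; rewrite sumEFin big_seq.
Qed.

Lemma eq_mconv P P' Q Q' x y t :
  (forall v r, v \in s -> 0 <= r <= t -> P x v r = P' x v r) ->
  (forall v r, v \in s -> 0 <= r <= t -> Q v y r = Q' v y r) ->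
  mconv P Q x y t = mconv P' Q' x y t.
Proof.
move=> PP QQ; apply: eq_big_seq => v vs.
by apply: eq_cconv => r rt; [exact: PP|exact: QQ].
Qed.

Lemma mconv_cont0 P Q : cont0_kernel P -> cont0_kernel Q ->
  cont0_kernel (mconv P Q).
Proof.
move=> cP cQ x y Ax Ay; apply: cont0_sumr => v /sA Av.
by apply: cconv_cont0; [exact: cP|exact: cQ].
Qed.

Lemma mconvA P Q S x y t : cont0_kernel P -> cont0_kernel Q -> cont0_kernel S ->
  A x -> A y -> 0 <= t ->
  mconv (mconv P Q) S x y t = mconv P (mconv Q S) x y t.
Proof.
move=> cP cQ cS Ax Ay t0.
transitivity (\sum_(v <- s) \sum_(u <- s) cconv (P x u) (cconv (Q u v) (S v y)) t).
  apply: eq_big_seq => v /sA Av; rewrite cconv_suml; last 2 first.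
  - by move=> u /sA Au; apply: cconv_cont0; [exact: cP|exact: cQ].
  - exact: cS.
  apply: eq_big_seq => u /sA Au.
  by apply: cconvA => //; [exact: cP|exact: cQ|exact: cS].
rewrite exchange_big; apply: eq_big_seq => u /sA Au; rewrite cconv_sumr//.
- by move=> v /sA Av; apply: cconv_cont0; [exact: cQ|exact: cS].
- exact: cP.
Qed.

Variable K : V -> V -> R -> R.
Hypotheses (cK : cont0_kernel K) (rK : rows_in K).

(** The power of exponent [n.+1], shifted so that [n] is also the exponent of t in its bound. *)
Let kpow n := convolution_power A K n.+1.

Lemma convolution_power_regular n : cont0_kernel (kpow n) /\ rows_in (kpow n).
Proof.
elim: n => [|n [cn rn]]; first by [].
have E x y t : A x -> A y -> 0 <= t -> kpow n.+1 x y t = mconv (kpow n) K x y t.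
  by move=> Ax Ay t0; exact: convolution_mconv.
split=> [x y Ax Ay|x y t Ax xs Ay t0].
  apply: cont0_eq (mconv_cont0 cn cK Ax Ay) => t t0; by rewrite E.
rewrite E// /mconv big1_seq// => v /= /sA Av.
rewrite -[RHS](cconv0l (K v y) t); apply: eq_cconv => // r /andP[r0 _].
exact: rn.
Qed.

Lemma convolution_powerSr n x y t : A x -> A y -> 0 <= t ->
  kpow n.+1 x y t = mconv (kpow n) K x y t.
Proof.
have [cn rn] := convolution_power_regular n.
by move=> Ax Ay t0; exact: convolution_mconv.
Qed.

Lemma convolution_powerSl n x y t : A x -> A y -> 0 <= t ->
  kpow n.+1 x y t = mconv K (kpow n) x y t.
Proof.
elim: n x y t => [|n ih] x y t Ax Ay t0; first exact: convolution_powerSr.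
have [cn rn] := convolution_power_regular n.
rewrite convolution_powerSr//.
rewrite (@eq_mconv _ (mconv K (kpow n)) _ K)//; last first.
  by move=> v r /sA Av /andP[r0 _]; rewrite ih.
rewrite mconvA//; apply: eq_mconv => // v r /sA Av /andP[r0 _].
by rewrite convolution_powerSr.
Qed.

(** The bound is uniform over a possibly infinite [A]: rows outside [s] vanish, and finitely many
    pairs of vertices remain, each giving a continuous function on a segment. *)
Lemma kernel_bounded (ys : seq V) (T : R) : (forall y, y \in ys -> A y) ->
  exists2 c, 0 <= c & forall x y t, A x -> y \in ys -> 0 <= t <= T ->
    `|K x y t| <= c.
Proof.
move=> ysA.
have [|p ps|c c0 bc] := @finite_uniform_bound R _ [seq (x, y) | x <- s, y <- ys]
  (fun p c => forall t, 0 <= t <= T -> `|K p.1 p.2 t| <= c).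
- by move=> p c d pc cd t tT; exact: le_trans (pc t tT) cd.
- have /allpairsP[q [/sA A1 /ysA A2 ->]] := ps.
  by have [c _ bc] := cont0_bounded T (cK A1 A2); exists c.
exists c => // x y t Ax yys tT.
have [xs|xs] := boolP (x \in s).
  by apply: (bc (x, y)) => //; apply/allpairsP; exists (x, y).
by rewrite rK ?normr0//; [exact: ysA|case/andP: tT].
Qed.

(** * Factorial bounds and the rate of convergence of the Neumann series *)

Section Bound.
Variables (ys : seq V) (T c : R).
Hypotheses (ysA : forall y, y \in ys -> A y) (c0 : 0 <= c).
Hypothesis bK : forall x y t, A x -> y \in ys ++ s -> 0 <= t <= T ->
  `|K x y t| <= c.

(** The columns in [s] join those in [ys] because the induction meets the entries [kpow n x v] with
    v in [s]. Each further factor costs [c], a sum of [size s] terms, and an integration. *)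
Lemma convolution_power_bound n x y t : A x -> y \in ys ++ s -> 0 <= t <= T ->
  `|kpow n x y t| <= c * ((size s)%:R * c) ^+ n / n`!%:R * t ^+ n.
Proof.
elim: n x y t => [|n ih] x y t Ax yys tT.
  by rewrite !expr0 !mulr1 divr1 bK.
have Ay : A y by move: yys; rewrite mem_cat => /orP[/ysA|/sA].
have /andP[t0 t_T] := tT.
rewrite convolution_powerSr// /mconv.
apply: (le_trans (ler_norm_sum _ _ _)).
set a := c * _ ^+ n / n`!%:R in ih *.
have a0 : 0 <= a.
  by rewrite /a divr_ge0// mulr_ge0// exprn_ge0// mulr_ge0.
have [cn _] := convolution_power_regular n.
apply: (@le_trans _ _ (\sum_(v <- s) a * c * (t ^+ n.+1 / n.+1%:R))).
  rewrite big_seq [leRHS]big_seq; apply: ler_sum => v vs; have Av := sA vs.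
  have vys : v \in ys ++ s by rewrite mem_cat vs orbT.
  apply: cconv_bound => //; [exact: cn|exact: cK| |].
    by move=> r /andP[r0 rt]; apply: ih; rewrite // r0 (le_trans rt).
  by move=> r /andP[r0 rt]; apply: bK; rewrite // r0 (le_trans rt).
rewrite big_const_seq count_predT iter_addr addr0 -mulr_natl /a.
rewrite factS natrM exprS le_eqVlt; apply/orP; left; apply/eqP.
have n1 : n.+1%:R != 0 :> R by rewrite pnatr_eq0.
have nf : n`!%:R != 0 :> R by rewrite pnatr_eq0 -lt0n fact_gt0.
rewrite [((size s)%:R * c) ^+ n.+1]exprS; field.
by rewrite nf addrC natr1.
Qed.

(** Terms of the series for c exp(|s| c T), moved up by one index because the Neumann series starts
    at exponent 1. *)
Definition neumann_majorant (l : nat) : R :=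
  if l is n.+1 then c * exp_coeff ((size s)%:R * c * T) n else 0.

Lemma neumann_majorant_cvg : cvgn (series neumann_majorant).
Proof.
have /cvg_ex[l cl] : cvgn (series (c *: exp_coeff ((size s)%:R * c * T))).
  by apply: is_cvg_seriesZ; exact: is_cvg_series_exp_coeff.
apply/cvg_ex; exists l; rewrite -cvg_shiftS.
apply: cvg_trans cl; apply: near_eq_cvg; near=> n.
by rewrite /series/= [RHS]big_nat_recl//= add0r.
Unshelve. all: end_near. Qed.

Lemma neumann_term_le l x y t : A x -> y \in ys ++ s -> 0 <= t <= T ->
  (0 < l)%N -> `|neumann_term A K l x y t| <= neumann_majorant l.
Proof.
move=> Ax yys tT; case: l => // n _.
rewrite /neumann_term normrM normrX normrN1 expr1n mul1r.
apply: (le_trans (convolution_power_bound n Ax yys tT)).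
have /andP[t0 t_T] := tT.
have -> : neumann_majorant n.+1 = c * ((size s)%:R * c) ^+ n / n`!%:R * T ^+ n.
  by rewrite /= /exp_coeff/= exprMn; ring.
rewrite ler_wpM2l//; last by rewrite lerXn2r// nnegrE// (le_trans t0).
by rewrite divr_ge0// mulr_ge0// exprn_ge0// mulr_ge0.
Qed.

(** Index 0 must be overwritten by 0: the exponent 0 is a default case in which [convolution_power]
    returns the kernel itself. *)
Lemma neumann_partial_sums l x y t :
  \sum_(1 <= i < l) neumann_term A K i x y t =
  series (fun i => if i is _.+1 then neumann_term A K i x y t else 0) l.
Proof.
rewrite /series/=; case: l => [|l]; first by rewrite !big_geq.
by rewrite [RHS]big_nat_recl// add0r big_add1.
Qed.

Lemma neumann_abs_partial_sums l x y t :
  \sum_(1 <= i < l) `|neumann_term A K i x y t| =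
  series (fun i => if i is _.+1 then `|neumann_term A K i x y t| else 0) l.
Proof.
rewrite /series/=; case: l => [|l]; first by rewrite !big_geq.
by rewrite [RHS]big_nat_recl// add0r big_add1.
Qed.

Let D : set (V * V * R) :=
  [set p | [/\ A p.1.1, p.1.2 \in ys ++ s & 0 <= p.2 <= T]].

Lemma neumann_series_dist : exists2 eps : nat -> R, eps @ \oo --> 0 &
  forall x y t, A x -> y \in ys ++ s -> 0 <= t <= T -> forall n,
    `|neumann_series A K x y t - \sum_(1 <= i < n) neumann_term A K i x y t|
    <= eps n.
Proof.
pose u i (p : V * V * R) :=
  if i is _.+1 then neumann_term A K i p.1.1 p.1.2 p.2 else 0.
have [|eps eps0 ueps] := @weierstrass_test R _ D u _ neumann_majorant_cvg.
  move=> [|n] p [Ax yys tT]; first by rewrite /= normr0.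
  exact: neumann_term_le.
exists eps => // x y t Ax yys tT n.
have [_ /(_ n)] := ueps (x, y, t) (And3 Ax yys tT).
rewrite -neumann_partial_sums => h; apply: le_trans h.
by rewrite /neumann_series (funext (fun m => neumann_partial_sums m x y t)).
Qed.

Lemma neumann_abs_dist : exists2 eps : nat -> R, eps @ \oo --> 0 &
  forall x y t, A x -> y \in ys ++ s -> 0 <= t <= T -> forall n,
    `|limn (fun n => \sum_(1 <= i < n) `|neumann_term A K i x y t|)
      - \sum_(1 <= i < n) `|neumann_term A K i x y t| | <= eps n.
Proof.
pose u i (p : V * V * R) :=
  if i is _.+1 then `|neumann_term A K i p.1.1 p.1.2 p.2| else 0.
have [|eps eps0 ueps] := @weierstrass_test R _ D u _ neumann_majorant_cvg.
  move=> [|n] p [Ax yys tT]; first by rewrite /= normr0.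
  by rewrite /u normr_id; exact: neumann_term_le.
exists eps => // x y t Ax yys tT n.
have [_ /(_ n)] := ueps (x, y, t) (And3 Ax yys tT).
rewrite -neumann_abs_partial_sums => h; apply: le_trans h.
by rewrite (funext (fun m => neumann_abs_partial_sums m x y t)).
Qed.

End Bound.

Lemma kernel_bounded_cat (ys : seq V) (T : R) : (forall y, y \in ys -> A y) ->
  exists2 c, 0 <= c & forall x y t, A x -> y \in ys ++ s -> 0 <= t <= T ->
    `|K x y t| <= c.
Proof.
by move=> ysA; apply: kernel_bounded => y; rewrite mem_cat => /orP[/ysA|/sA].
Qed.

Lemma neumann_series_converges (C : set (spacetime R V)) :
  compact C -> C `<=` spacetime_domain A ->
  abs_unif_converges C (neumann_term A K) (neumann_series A K).
Proof.
move=> /compact_spacetime[ys [T bC]] CA.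
(* Compactness yields a list that merely covers the second vertices; the kernel is controlled only
   at those in [A]. *)
pose ys' := [seq y <- ys | y \in A].
have ysA y : y \in ys' -> A y by rewrite mem_filter => /andP[/set_mem].
have [c c0 bK] := kernel_bounded_cat T ysA.
have dom p : C p -> [/\ A p.1.1, p.1.2 \in ys' ++ s & 0 <= p.2 <= T].
  move=> Cp; have [A1 A2 p0] := CA p Cp; have [pys pT] := bC p Cp.
  by split; rewrite ?p0// mem_cat mem_filter pys andbT mem_set.
split.
  have [eps eps0 epsP] := neumann_abs_dist ysA c0 bK.
  exists (fun p => limn (fun n =>
    \sum_(1 <= i < n) `|neumann_term A K i p.1.1 p.1.2 p.2|)).
  apply: (uniform_of_dist eps0) => n p /dom[p1 p2 p3]; exact: epsP.
have [eps eps0 epsP] := neumann_series_dist ysA c0 bK.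
by apply: (uniform_of_dist eps0) => n p /dom[p1 p2 p3]; exact: epsP.
Qed.

Let partial n x y t := \sum_(1 <= i < n) neumann_term A K i x y t.

Lemma neumann_term_cont0 i : cont0_kernel (neumann_term A K i).
Proof.
move=> x y Ax Ay; apply: cont0M; first exact: cont0_cst.
by case: i => [|i]; [exact: cK|have [c _] := convolution_power_regular i; exact: c].
Qed.

Lemma neumann_partial_cont0 n : cont0_kernel (partial n).
Proof. by move=> x y Ax Ay; apply: cont0_sum => i; exact: neumann_term_cont0. Qed.

Lemma neumann_series_cont0 : cont0_kernel (neumann_series A K).
Proof.
move=> x y Ax Ay; apply: cont0_segments => T T0.
have ysA z : z \in [:: y] -> A z by rewrite inE => /eqP->.
have [c c0 bK] := kernel_bounded_cat T ysA.
have [eps eps0 epsP] := neumann_series_dist ysA c0 bK.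
apply: (@uniform_limit_continuous_subspace _ R `[0, T]%classic
  ((fun n => partial n x y) @ \oo)).
  exists 0%N => // n _ /=.
  apply: continuous_subspaceW (@neumann_partial_cont0 n x y Ax Ay).
  by move=> t /=; rewrite !in_itv/= => /andP[->].
apply: (uniform_of_dist eps0) => n t; rewrite /= in_itv/= => tT.
by apply: epsP => //; rewrite mem_cat mem_head.
Qed.

Lemma neumann_series_rows : rows_in (neumann_series A K).
Proof.
move=> x y t Ax xs Ay t0; rewrite /neumann_series.
rewrite (_ : (fun n => _) = cst 0) ?lim_cst//; apply/funext => n /=.
apply: big1_seq => i _; rewrite /neumann_term.
case: i => [|i]; first by rewrite /convolution_power/= rK ?mulr0.
have [_ r] := convolution_power_regular i.
by rewrite [convolution_power _ _ _ _ _ _]r ?mulr0.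
Qed.

(** Finite form of the resolvent identity: the first power is split off and [K] is factored out of
    the others on the left. [partial n.+2] ends with exponent [n.+1], [partial n.+1] with exponent
    [n]. *)
Lemma neumann_partialS n x y t : A x -> A y -> 0 <= t ->
  partial n.+2 x y t = - K x y t - mconv K (partial n.+1) x y t.
Proof.
move=> Ax Ay t0; rewrite /partial big_ltn// {1}/neumann_term expr1 mulN1r.
congr (_ + _); rewrite big_add1/= /mconv.
rewrite -sumrN.
transitivity (\sum_(v <- s) \sum_(1 <= i < n.+1)
  - cconv (K x v) (neumann_term A K i v y) t).
  rewrite exchange_big/=; apply: eq_big_nat => -[//|i] _.
  rewrite /neumann_term [convolution_power _ _ _ _ _ _]convolution_powerSl//.
  rewrite /mconv mulr_sumr.
  apply: eq_big_seq => v /sA Av; rewrite cconvZr//.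
  - by rewrite exprS mulN1r mulNr.
  - exact: cK.
  - by have [ci _] := convolution_power_regular i; exact: ci.
apply: eq_big_seq => v /sA Av; rewrite sumrN cconv_sumr//; last exact: cK.
by move=> i _; exact: neumann_term_cont0.
Qed.

(* The powers are built by right multiplication; associativity gives the
   recursion with K on the left, which is the one a resolvent needs. *)
Lemma neumann_series_resolvent x y t : A x -> A y -> 0 <= t ->
  neumann_series A K x y t =
  - K x y t - mconv K (neumann_series A K) x y t.
Proof.
move=> Ax Ay t0.
have ysA z : z \in [:: y] -> A z by rewrite inE => /eqP->.
have yys : y \in [:: y] ++ s by rewrite mem_cat mem_head.
have [c c0 bK] := kernel_bounded_cat t ysA.
have [eps eps0 epsP] := neumann_series_dist ysA c0 bK.
have tt : 0 <= t <= t by rewrite t0 lexx.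
have pcvg v r : A v -> 0 <= r <= t ->
    partial n v y r @[n --> \oo] --> neumann_series A K v y r.
  move=> Av rt; apply/cvgrPdist_le => e e0.
  move/cvgrPdist_le : eps0 => /(_ _ e0); apply: filterS => n.
  rewrite sub0r normrN => epsn; apply: le_trans (epsP v y r Av yys rt n) _.
  exact: le_trans (ler_norm _) epsn.
have L : partial n.+2 x y t @[n --> \oo] --> neumann_series A K x y t.
  by have := pcvg x t Ax tt; rewrite -(cvg_shiftn 2); under eq_fun do rewrite addn2.
have M : mconv K (partial n.+1) x y t @[n --> \oo]
    --> mconv K (neumann_series A K) x y t.
  rewrite /mconv; under eq_fun do rewrite big_seq; rewrite big_seq.
  apply: cvg_big => [|v vs]; first by move=> ?; exact: add_continuous.
  have Av := sA vs.
  have [a a0 ba] := cont0_bounded t (cK Ax Av).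
  have cF := neumann_series_cont0 Av Ay.
  have cp n := @neumann_partial_cont0 n v y Av Ay.
  apply/cvgrPdist_le => e e0.
  (* Convolution with [K x v], bounded by [a] on [[0, t]], enlarges a uniform error by a factor of
     at most a t. The added 1 keeps the quotient meaningful when a t = 0. *)
  have e1 : 0 < e / (a * t + 1) by rewrite divr_gt0// ltr_wpDl// mulr_ge0.
  have /cvgrPdist_le/(_ _ e1) : eps n.+1 @[n --> \oo] --> 0 by rewrite cvg_shiftS.
  apply: filterS => n; rewrite sub0r normrN => epsn.
  have -> : cconv (K x v) (neumann_series A K v y) t
      - cconv (K x v) (partial n.+1 v y) t
    = cconv (K x v)
        (fun r => neumann_series A K v y r + -1 * partial n.+1 v y r) t.
    rewrite cconvDr//; last 2 first.
    - exact: cK.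
    - by apply: cont0M => //; exact: cont0_cst.
    by rewrite cconvZr ?mulN1r//; exact: cK.
  apply: (@le_trans _ _ (a * (e / (a * t + 1)) * (t ^+ 1 / 1%:R))).
    apply: cconv_bound => //.
    - exact: cK.
    - by apply: cont0D => //; apply: cont0M => //; exact: cont0_cst.
    - by move=> r rt; rewrite expr0 mulr1; exact: ba.
    - move=> r rt; rewrite mulN1r (le_trans (epsP v y r Av yys rt n.+1))//.
      exact: le_trans (ler_norm _) epsn.
  rewrite expr1 divr1 mulrAC mulrA ler_pdivrMr; last by rewrite ltr_wpDl// mulr_ge0.
  by rewrite mulrC ler_wpM2l// ?lerDl// ltW.
rewrite -(cvg_lim (@Rhausdorff R) L); apply: (cvg_lim (@Rhausdorff R)).
rewrite (_ : (fun n => _) = fun n => - K x y t - mconv K (partial n.+1) x y t).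
  by apply: cvgB => //; exact: cvg_cst.
by apply/funext => n; exact: neumann_partialS.
Qed.

End Volterra.

(** * Time derivatives on [0, +oo[ *)

Section TimeDerivative.
Variable R : realType.
Implicit Types (p q : R -> R) (t : R).

(** A convergence statement determines the value of [lim] only along a proper filter. The increment
    [e / 2] is positive, hence admissible at t = 0 too. *)
Let domain_proper t : 0 <= t -> ProperFilter (within [set h : R | 0 <= t + h] 0^').
Proof.
move=> t0; apply: Build_ProperFilter_ex => P [e /= e0 eP].
exists (e / 2); apply: eP => /=.
- by rewrite sub0r normrN gtr0_norm ?divr_gt0// ltr_pdivrMr// ltr_pMr// ltr1n.
- by rewrite gt_eqF// divr_gt0.
- by rewrite addr_ge0// ltW// divr_gt0.
Qed.

Lemma time_derivative_pos p d t : 0 < t -> is_derive t 1 p d ->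
  time_derivative p t = d.
Proof.
move=> t0 [dp <-].
have PF := domain_proper (ltW t0).
apply: (cvg_lim (@Rhausdorff R)).
have : h^-1 *: (p (h *: (1 : R) + t) - p t) @[h --> 0^'] --> 'D_1 p t by exact: dp.
apply: cvg_trans => P GP.
change (\forall h \near 0^', 0 <= t + h -> P (h^-1 * (p (t + h) - p t))).
have {}GP : \forall h \near 0^', P (h^-1 *: (p (h *: (1 : R) + t) - p t)) by [].
near=> h => _; have : P (h^-1 *: (p (h *: (1 : R) + t) - p t)) by near: h.
by rewrite /GRing.scale/= mulr1 (addrC h).
Unshelve. all: end_near. Qed.

(** By the mean value theorem the difference quotient at 0 is a value of [q] at an intermediate
    time, and [q] is continuous at 0. This is what makes L H0 continuous up to t = 0. *)
Lemma time_derivative_0 p q : cont0 p -> cont0 q ->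
  (forall s : R, 0 < s -> is_derive s 1 p (q s)) -> time_derivative p 0 = q 0.
Proof.
move=> cp cq dp; have PF := domain_proper (lexx 0).
apply: (cvg_lim (@Rhausdorff R)).
apply/cvgrPdist_le => e e0.
have /continuous_within_itvcyP[_ /cvgrPdist_le/(_ _ e0)[d /= d0 qd]] := cq.
exists d => // h /= hd hn0; rewrite !add0r => h0; rewrite sub0r normrN in hd.
have {hn0}h0 : 0 < h by rewrite lt_neqAle eq_sym hn0.
rewrite gtr0_norm// in hd.
have [|||c] := @MVT R p q 0 h => //.
- by move=> s; rewrite in_itv/= => /andP[s0 _]; exact: dp.
- by apply: continuous_subspaceW cp => x /=; rewrite !in_itv/= => /andP[->].
rewrite in_itv/= subr0 => /andP[c0 ch] ->.
rewrite mulrC mulfK ?gt_eqF//.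
by apply: qd => //=; rewrite sub0r normrN gtr0_norm// (lt_trans ch).
Qed.

Lemma time_derivative_ge0 p q t : cont0 p -> cont0 q ->
  (forall s : R, 0 < s -> is_derive s 1 p (q s)) -> 0 <= t ->
  time_derivative p t = q t.
Proof.
move=> cp cq dp; rewrite le_eqVlt => /predU1P[<-|t0].
  exact: time_derivative_0.
by apply: time_derivative_pos => //; exact: dp.
Qed.

(** The filter of the initial condition contains the time 0 itself, so the limit also fixes the
    value there. *)
Lemma cont0_initial p d : (forall t, 0 < t -> derivable p t 1) ->
  p t @[t --> within [set t | 0 <= t] (nbhs (0 : R))] --> d ->
  p 0 = d /\ cont0 p.
Proof.
move=> dp pd.
have p0 : p 0 = d.
  apply/eqP; rewrite -subr_eq0 -normr_le0; apply/ler_addgt0Pr => e e0.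
  rewrite add0r distrC; move/cvgrPdist_le : pd => /(_ _ e0).
  by rewrite near_withinE => /nbhs_singleton; apply; rewrite /=.
split=> //; apply/continuous_within_itvcyP; split.
  move=> t; rewrite in_itv/= andbT => /dp dpt.
  by apply: differentiable_continuous; apply/derivable1_diffP.
rewrite p0; apply: cvg_trans pd; apply: cvg_app => P.
move=> wP; change (\forall x \near (0 : R), 0 < x -> P x).
have {}wP : \forall x \near (0 : R), 0 <= x -> P x by [].
near=> x => /ltW; near: x; exact: wP.
Unshelve. all: end_near. Qed.

Lemma cont0_cvg_initial p : cont0 p ->
  p t @[t --> within [set t | 0 <= t] (nbhs (0 : R))] --> p 0.
Proof.
move=> /subspace_continuousP/(_ 0); rewrite /= in_itv/= lexx => /(_ isT).
by under eq_set do rewrite in_itv/= andbT.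
Qed.

Lemma integral_X n t : 0 <= t ->
  (\int[lebesgue_measure]_(r in `[0%R, t]) (r ^+ n : R))%R = t ^+ n.+1 / n.+1%:R.
Proof.
move=> t0; have n1 : n.+1%:R != 0 :> R by rewrite pnatr_eq0.
have cX m : cont0 (fun r : R => r ^+ m).
  by apply: continuous_subspaceT; exact: exprn_continuous.
have cp : cont0 (fun r : R => n.+1%:R^-1 * r ^+ n.+1).
  by apply: cont0M; [exact: cont0_cst|exact: cX].
have dp (s : R) : 0 < s ->
    is_derive s 1 (fun r : R => n.+1%:R^-1 * r ^+ n.+1) (s ^+ n).
  move=> s0; rewrite (_ : (fun r : R => _) = n.+1%:R^-1 *: (id ^+ n.+1)); last first.
    by apply/funext => r; rewrite exprfctE.
  by apply: is_derive_eq; rewrite /GRing.scale/= mulr1 mulKf.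
have := primitive_FTC2 cp (cX n) dp t0.
by rewrite expr0n mulr0 add0r mulrC => <-.
Qed.

Lemma growth_bound p q (a T : R) n t : cont0 p -> cont0 q -> p 0 = 0 ->
  (forall s : R, 0 < s -> is_derive s 1 p (q s)) ->
  (forall s, 0 <= s <= T -> `|q s| <= a * s ^+ n) -> 0 <= t <= T ->
  `|p t| <= a * (t ^+ n.+1 / n.+1%:R).
Proof.
move=> cp cq p0 dp bq /andP[t0 tT].
have cX : continuous (fun r : R => r ^+ n) by exact: exprn_continuous.
rewrite (primitive_FTC2 cp cq dp t0) p0 add0r.
apply: (le_trans (le_normr_Rintegral _ (cont0_integrable t cq))) => //.
rewrite -integral_X// -RintegralZl//; last exact: integrable_continuous.
apply: le_Rintegral => //.
- by have := cont0_integrable t cq => /integrable_norm.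
- by apply: integrable_continuous => r; apply: cvgM; [exact: cvg_cst|exact: cX].
- move=> r; rewrite /= in_itv/= => /andP[r0 rt]; apply: bq.
  by rewrite r0 (le_trans rt).
Qed.

End TimeDerivative.

Lemma solves_heat_initial (R : realType) (V : choiceType) (A : set V)
    (w : V -> V -> R) (H : V -> V -> R -> R) x y :
  solves_heat_at A w H x y -> initial_delta_at H x y ->
  [/\ cont0 (H x y), H x y 0 = (x == y)%:R &
      forall t : R, 0 < t ->
        is_derive t 1 (H x y) (- laplacian A w (fun v => H v y t) x)].
Proof.
move=> sH iH.
have [H0 cH] := cont0_initial (fun t t0 => (sH t t0).1) iH.
split=> // t t0; have [dH hH] := sH t t0.
have dH' : is_derive t 1 (H x y) ('D_1 (H x y) t) by exact: derivableP.
move: hH; rewrite /heat_operator (time_derivative_pos t0 dH') addrC.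
by move/eqP; rewrite addr_eq0 => /eqP <-.
Qed.

(** * Weights of a subgraph near its boundaries *)

Section Subgraph.
Variables (R : realType) (V : choiceType) (wt : V -> V -> R).
Variables (A : set V) (w : V -> V -> R).
Hypotheses (hwt : weighted_graph [set: V] wt)
  (hval : bounded_valence [set: V] wt)
  (hsub : subgraph A w [set: V] wt).
Let B := boundary A w [set: V] wt.

Definition neighbours (x : V) : {fset V} :=
  fset_set [set y | [set: V] y /\ wt x y != 0].

(** With weights extended by 0, sums over [A], over its interior and over the big graph all run over
    the same finite list [neighbours wt x] and can be compared term by term. *)
Definition zero_extension (D : set V) (x y : V) : R :=
  if y \in D then w x y else 0.

Lemma neighboursE x y : (y \in neighbours x) = (wt x y != 0).
Proof.
rewrite /neighbours in_fset_set; last exact: hval.1.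
by apply/idP/idP => [/set_mem[]//|ne]; exact/mem_set.
Qed.

Lemma subgraph_weight0 x y : A x -> A y -> wt x y = 0 -> w x y = 0.
Proof. by case: hsub => _ _ /[apply] /[apply] -[->|]. Qed.

Lemma sum_neighbours (D : set V) (g : V -> R) x : A x -> D `<=` A ->
  \sum_(y \in D) g y * w x y =
  \sum_(y <- neighbours x) g y * zero_extension D x y.
Proof.
move=> Ax DA; rewrite fsbig_mkcond (fsbigTE (neighbours x)).
  by apply: eq_bigr => y _; rewrite /patch /zero_extension; case: ifP; rewrite ?mulr0.
move=> y; rewrite neighboursE negbK => /eqP wt0; rewrite /patch; case: ifPn => //.
by move=> /set_mem/DA Ay; rewrite subgraph_weight0// mulr0.
Qed.

Lemma sum_wt_neighbours (g : V -> R) x :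
  \sum_(y \in [set: V]) g y * wt x y = \sum_(y <- neighbours x) g y * wt x y.
Proof.
apply: fsbigTE => y; rewrite neighboursE negbK => /eqP ->; exact: mulr0.
Qed.

Lemma valence_sum (D : set V) x : A x -> D `<=` A ->
  valence D w x = \sum_(y <- neighbours x) zero_extension D x y.
Proof.
move=> Ax DA; rewrite /valence.
transitivity (\sum_(y \in D) 1 * w x y).
  by apply: eq_fsbigr => y _; rewrite mul1r.
by rewrite sum_neighbours//; apply: eq_bigr => y _; rewrite mul1r.
Qed.

Lemma valence_wt_sum x : valence [set: V] wt x = \sum_(y <- neighbours x) wt x y.
Proof.
rewrite /valence; transitivity (\sum_(y \in [set: V]) 1 * wt x y).
  by apply: eq_fsbigr => y _; rewrite mul1r.
by rewrite sum_wt_neighbours//; apply: eq_bigr => y _; rewrite mul1r.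
Qed.

Lemma laplacian_sum (f : V -> R) x : A x ->
  laplacian A w f x =
  \sum_(y <- neighbours x) (f x - f y) * zero_extension A x y.
Proof. by move=> Ax; exact: (@sum_neighbours A (fun y => f x - f y)). Qed.

Lemma wt_ge0 x y : 0 <= wt x y. Proof. exact: hwt.2. Qed.

Lemma zero_extension_ge0 D x y : A x -> D `<=` A -> 0 <= zero_extension D x y.
Proof.
move=> Ax DA; rewrite /zero_extension; case: ifPn => // /set_mem/DA Ay.
by have [_ _ /(_ x y Ax Ay)[->|->]] := hsub; rewrite ?wt_ge0.
Qed.

Lemma zero_extension_le D E x y : A x -> D `<=` E -> E `<=` A ->
  zero_extension D x y <= zero_extension E x y.
Proof.
move=> Ax DE EA; rewrite {1}/zero_extension; case: ifPn => [/set_mem/DE Ey|_].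
  by rewrite /zero_extension mem_set.
exact: zero_extension_ge0.
Qed.

Lemma zero_extension_le_wt x y : A x -> zero_extension A x y <= wt x y.
Proof.
move=> Ax; rewrite /zero_extension; case: ifPn => [/set_mem Ay|_].
  by have [_ _ /(_ x y Ax Ay)[->|->]] := hsub; rewrite ?wt_ge0.
exact: wt_ge0.
Qed.

(** The equality case of termwise comparison; it turns a comparison of valences into equality of
    weights. *)
Lemma sum_eq_of_le (I : eqType) (l : seq I) (f g : I -> R) :
  (forall i, f i <= g i) -> \sum_(i <- l) g i <= \sum_(i <- l) f i ->
  {in l, f =1 g}.
Proof.
move=> fg gf i il; apply/eqP; rewrite eq_sym -subr_eq0.
have : \sum_(i <- l) (g i - f i) == 0.
  by rewrite sumrB subr_eq0 eq_le gf ler_sum.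
rewrite psumr_eq0; last by move=> j _; rewrite subr_ge0.
by move=> /allP/(_ i il).
Qed.

(** Off the boundary the valence in G is not smaller than in the big graph, while every weight is at
    most the big one; so all weights agree. In particular x has no neighbour outside [A]. *)
Lemma interior_weight x y : (A `\` B) x -> zero_extension A x y = wt x y.
Proof.
move=> [Ax nBx].
have [|] := boolP (y \in neighbours x); last first.
  rewrite neighboursE negbK => /eqP w0; rewrite w0 /zero_extension.
  by case: ifPn => // /set_mem Ay; rewrite subgraph_weight0.
apply: sum_eq_of_le => [z|]; first exact: zero_extension_le_wt.
rewrite -valence_sum// -valence_wt_sum leNgt; apply/negP => lt.
by apply: nBx; split.
Qed.

(** The same rigidity for the interior inside G: x has no neighbour in [B], the vertices of [A] at
    which the parametrix was cut to 0. *)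
Lemma deep_interior_weight x y : (A `\` B) x ->
  ~ boundary (A `\` B) w A w x -> B y -> wt x y = 0.
Proof.
move=> ABx nbx By; have [Ax _] := ABx; have Ay : A y by case: By.
apply/eqP; apply: contrapT => /negP; rewrite -neighboursE => yN.
have : zero_extension (A `\` B) x y = zero_extension A x y.
  apply: (sum_eq_of_le _ _ yN) => [z|].
    by apply: zero_extension_le => // ? [].
  rewrite -valence_sum// -valence_sum//.
  by rewrite leNgt; apply/negP => lt; apply: nbx; split.
rewrite (interior_weight y ABx) {1}/zero_extension ifN; last first.
  by apply/negP => /set_mem[].
by move=> /esym/eqP; move: yN; rewrite neighboursE => /negP.
Qed.

End Subgraph.

(** * Uniqueness of the Dirichlet heat kernel *)

Section Uniqueness.
Variables (R : realType) (V : choiceType) (wt : V -> V -> R).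
Variables (A : set V) (w : V -> V -> R).
Hypotheses (hwt : weighted_graph [set: V] wt)
  (hval : bounded_valence [set: V] wt)
  (hsub : subgraph A w [set: V] wt).
Let B := boundary A w [set: V] wt.

(* Picard iteration on the difference: since the Laplacian is bounded by 2M in
   the sup norm, a bound C (2M)^n t^n / n! improves to the one for n + 1. *)
Lemma dirichlet_heat_kernel_unique H1 H2 x y t :
  is_dirichlet_heat_kernel A B w H1 -> is_dirichlet_heat_kernel A B w H2 ->
  A x -> A y -> 0 <= t -> H1 x y t = H2 x y t.
Proof.
move=> [s1 i1 d1 b1] [s2 i2 d2 b2] Ax Ay t0.
pose u v r := H1 v y r - H2 v y r.
pose wA := zero_extension w A.
pose du v r := - (\sum_(z <- neighbours wt v) (u v r - u z r) * wA v z).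
have [M0 vM] := hval.2; pose M := `|M0|.
have uB v r : B v -> 0 <= r -> u v r = 0.
  by move=> Bv r0; rewrite /u d1// d2// subrr.
have cu v : A v -> cont0 (u v).
  move=> Av; have [Bv|nBv] := pselect (B v).
    by apply: (cont0_eq _ (@cont0_cst R 0)) => r r0; rewrite uB.
  have ABv : (A `\` B) v by [].
  have [c1 _ _] := solves_heat_initial (s1 v y ABv Ay) (i1 v y ABv Ay).
  have [c2 _ _] := solves_heat_initial (s2 v y ABv Ay) (i2 v y ABv Ay).
  by apply: cont0D => //; exact: cont0N.
have cdu v : A v -> cont0 (du v).
  move=> Av; apply: cont0N; apply: cont0_sum => z.
  have [Az|nAz] := pselect (A z).
    apply: cont0M; last exact: cont0_cst.
    by apply: cont0D; [exact: cu|apply: cont0N; exact: cu].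
  apply: (cont0_eq _ (@cont0_cst R 0)) => r r0.
  by rewrite /wA /zero_extension memNset// mulr0.
have u0 v : (A `\` B) v -> u v 0 = 0.
  move=> ABv.
  have [_ e1 _] := solves_heat_initial (s1 v y ABv Ay) (i1 v y ABv Ay).
  have [_ e2 _] := solves_heat_initial (s2 v y ABv Ay) (i2 v y ABv Ay).
  by rewrite /u e1 e2 subrr.
have udu v (r : R) : (A `\` B) v -> 0 < r -> is_derive r 1 (u v) (du v r).
  move=> ABv r0; have Av := ABv.1.
  have [_ _ e1] := solves_heat_initial (s1 v y ABv Ay) (i1 v y ABv Ay).
  have [_ _ e2] := solves_heat_initial (s2 v y ABv Ay) (i2 v y ABv Ay).
  have D1 := e1 r r0; have D2 := e2 r r0.
  apply: (is_derive_eq (is_deriveB D1 D2)).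
  rewrite !(laplacian_sum hval hsub)// /du opprK addrC -[RHS]sumrN -sumrB.
  by apply: eq_bigr => z _; rewrite /u /wA; ring.
have [C1 bC1] := b1 y Ay t; have [C2 bC2] := b2 y Ay t.
pose C := `|C1| + `|C2|.
have C0 : 0 <= C by rewrite addr_ge0.
have M0' : 0 <= M by exact: normr_ge0.
(* The start [n = 0] is the local boundedness of the two kernels. The bound is uniform over [A],
   since the Laplacian at v involves all its neighbours. *)
have ub n v r : A v -> 0 <= r <= t ->
    `|u v r| <= C * (2 * M) ^+ n / n`!%:R * r ^+ n.
  elim: n v r => [|n ih] v r Av rt.
    rewrite !expr0 divr1 !mulr1 (le_trans (ler_normB _ _))// lerD//.
      by rewrite (le_trans (bC1 v r Av rt))// ler_norm.
    by rewrite (le_trans (bC2 v r Av rt))// ler_norm.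
  have /andP[r0 r_t] := rt.
  have a0 : 0 <= C * (2 * M) ^+ n / n`!%:R.
    by rewrite divr_ge0// mulr_ge0// exprn_ge0// mulr_ge0.
  have [Bv|nBv] := pselect (B v).
    rewrite uB// normr0 mulr_ge0//; last exact: exprn_ge0.
    by rewrite divr_ge0// mulr_ge0// exprn_ge0// mulr_ge0.
  have ABv : (A `\` B) v by [].
  (* Each difference of values of [u] is at most twice the induction bound, and the weights at v sum
     to at most [M]; integrating in time gives the next power. *)
  apply: (le_trans (@growth_bound R (u v) (du v)
    (2 * (C * (2 * M) ^+ n / n`!%:R) * M) t n r (cu v Av) (cdu v Av) (u0 v ABv) (udu v ^~ ABv) _ rt)).
    move=> q qt; rewrite normrN (le_trans (ler_norm_sum _ _ _))//.
    apply: (@le_trans _ _ (\sum_(z <- neighbours wt v)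
        2 * (C * (2 * M) ^+ n / n`!%:R) * q ^+ n * wt v z)).
      apply: ler_sum => z _; rewrite normrM.
      have [Az|nAz] := pselect (A z); last first.
        have q0 : 0 <= q by case/andP: qt.
        rewrite /wA /zero_extension memNset// normr0 mulr0.
        by rewrite mulr_ge0// ?(wt_ge0 hwt)// mulr_ge0// ?exprn_ge0// mulr_ge0.
      apply: ler_pM => //.
        rewrite (le_trans (ler_normB _ _))// -mulrA mulrDl mul1r lerD//; exact: ih.
      rewrite ger0_norm; first exact: zero_extension_le_wt.
      exact: (zero_extension_ge0 hwt hsub).
    rewrite -mulr_sumr -valence_wt_sum// mulrAC ler_wpM2r//.
      by rewrite exprn_ge0//; case/andP: qt.
    rewrite ler_wpM2l//; first by rewrite mulr_ge0.
    by rewrite (le_trans (vM v I))// ler_norm.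
  rewrite factS natrM exprS le_eqVlt; apply/orP; left; apply/eqP.
  have n1 : n.+1%:R != 0 :> R by rewrite pnatr_eq0.
  have nf : n`!%:R != 0 :> R by rewrite pnatr_eq0 -lt0n fact_gt0.
  rewrite [(2 * M) ^+ n.+1]exprS; field.
  by rewrite nf addrC natr1.
apply/eqP; rewrite -subr_eq0 -normr_le0 -/(u x t).
have lim0 : C * exp_coeff (2 * M * t) n @[n --> \oo] --> 0.
  by rewrite -(mulr0 C); apply: cvgM; [exact: cvg_cst|exact: cvg_exp_coeff].
have cst_u : (fun=> `|u x t|) n @[n --> \oo] --> `|u x t| by exact: cvg_cst.
apply: (ler_cvg_to cst_u lim0).
exists 0%N => // n _ /=.
apply: le_trans (ub n x t Ax _) _; first by rewrite t0 lexx.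
rewrite /exp_coeff/= [(2 * M * t) ^+ n]exprMn le_eqVlt.
by apply/orP; left; apply/eqP; ring.
Qed.

End Uniqueness.

Lemma is_derive_sum_seq (R : realType) (I : eqType) (l : seq I)
    (f : I -> R -> R) (d : I -> R) (t : R) :
  {in l, forall i, is_derive t 1 (f i) (d i)} ->
  is_derive t 1 (\sum_(i <- l) f i) (\sum_(i <- l) d i).
Proof.
elim: l => [|i l ih] fd; first by rewrite !big_nil; exact: is_derive_cst.
rewrite !big_cons; apply: is_deriveD; first by apply: fd; rewrite mem_head.
by apply: ih => j jl; apply: fd; rewrite inE jl orbT.
Qed.

(** * The parametrix of the Dirichlet problem *)

Section Parametrix.
Variables (R : realType) (V : choiceType) (wt : V -> V -> R).
Variables (A : set V) (w : V -> V -> R) (Ht : V -> V -> R -> R).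
Hypotheses (hwt : weighted_graph [set: V] wt)
  (hval : bounded_valence [set: V] wt)
  (hsub : subgraph A w [set: V] wt).
Let B := boundary A w [set: V] wt.
Let B' := boundary (A `\` B) w A w.
Hypotheses (hbd : finite_set B) (hbd' : finite_set B')
  (hHt : is_heat_kernel [set: V] wt Ht).
Let H0 := parametrix A B Ht.
Let LH0 := heat_operator A w H0.
Let F := neumann_series A LH0.
Let wA := zero_extension w A.

Definition source_support : seq V := fset_set (B `|` B').
Let s := source_support.

Let s_uniq : uniq s. Proof. exact: fset_uniq. Qed.

Let mem_s v : (v \in s) = (v \in B `|` B').
Proof. by rewrite /s /source_support in_fset_set// finite_setU. Qed.

Let sA v : v \in s -> A v.
Proof. by rewrite mem_s => /set_mem[[]|[[]]]. Qed.

Let dHt x y t : R := - laplacian [set: V] wt (fun v => Ht v y t) x.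

Let Ht_facts x y : [/\ cont0 (Ht x y), Ht x y 0 = (x == y)%:R &
  forall t : R, 0 < t -> is_derive t 1 (Ht x y) (dHt x y t)].
Proof.
by have [sH iH _] := hHt; apply: solves_heat_initial; [exact: sH|exact: iH].
Qed.

Let dHt_cont0 x y : cont0 (dHt x y).
Proof.
apply: cont0N; apply: (@cont0_eq R (fun t =>
    \sum_(z <- neighbours wt x) (Ht x y t - Ht z y t) * wt x z)).
  by move=> t _; rewrite -(sum_wt_neighbours hval (fun z => Ht x y t - Ht z y t)).
apply: cont0_sum => z; apply: cont0M; last exact: cont0_cst.
have [cx _ _] := Ht_facts x y; have [cz _ _] := Ht_facts z y.
by apply: cont0D => //; exact: cont0N.
Qed.

(** The time derivative of [H0], expressed through the heat equation of the big graph; in this form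
    it is continuous at t = 0 as well. *)
Definition dparametrix x y t : R :=
  if (x \in A `\` B) && (y \in A) then dHt x y t else 0.

Lemma parametrix_in x y t : (A `\` B) x -> A y -> 0 <= t -> H0 x y t = Ht x y t.
Proof. by move=> Ax Ay t0; rewrite /H0 /parametrix !mem_set // t0. Qed.

Lemma parametrix_out x y t : ~ ((A `\` B) x /\ A y) -> H0 x y t = 0.
Proof.
move=> nx; rewrite /H0 /parametrix.
case: ifPn => // /and3P[/set_mem ? /set_mem ?].
by exfalso; apply: nx; split.
Qed.

Lemma parametrix_cont0 x y : cont0 (H0 x y).
Proof.
have [[Ax Ay]|nx] := pselect ((A `\` B) x /\ A y).
  have [c _ _] := Ht_facts x y.
  by apply: cont0_eq c => t t0; rewrite parametrix_in.
by apply: (cont0_eq _ (@cont0_cst R 0)) => t t0; rewrite parametrix_out.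
Qed.

Lemma dparametrix_cont0 x y : cont0 (dparametrix x y).
Proof.
have [xy|xy] := boolP ((x \in A `\` B) && (y \in A)).
  by apply: (cont0_eq _ (dHt_cont0 (x := x) (y := y))) => t _; rewrite /dparametrix xy.
by apply: (cont0_eq _ (@cont0_cst R 0)) => t _; rewrite /dparametrix (negbTE xy).
Qed.

Lemma parametrix_derive x y (t : R) : 0 < t ->
  is_derive t 1 (H0 x y) (dparametrix x y t).
Proof.
move=> t0; have [[Ax Ay]|nx] := pselect ((A `\` B) x /\ A y).
  have [_ _ d] := Ht_facts x y.
  rewrite /dparametrix (mem_set Ax) (mem_set Ay)/=.
  apply: near_eq_is_derive (d t t0).
  near=> r; rewrite parametrix_in//.
  by apply/ltW; near: r; exact: lt_nbhsr.
rewrite (_ : H0 x y = cst 0); last by apply/funext => r; exact: parametrix_out.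
rewrite /dparametrix ifF; first exact: is_derive_cst.
by apply/negP => /andP[/set_mem ? /set_mem ?]; apply: nx.
Unshelve. all: end_near. Qed.

Lemma parametrix_initial x y : (A `\` B) x -> A y -> H0 x y 0 = (x == y)%:R.
Proof. by move=> Ax Ay; rewrite parametrix_in//; case: (Ht_facts x y). Qed.

Lemma heat_parametrix x y t : A x -> 0 <= t ->
  LH0 x y t = \sum_(z <- neighbours wt x) (H0 x y t - H0 z y t) * wA x z
              + dparametrix x y t.
Proof.
move=> Ax t0; rewrite /LH0 /heat_operator (laplacian_sum hval hsub)//.
congr (_ + _); apply: time_derivative_ge0 => //.
- exact: parametrix_cont0.
- exact: dparametrix_cont0.
- by move=> r r0; exact: parametrix_derive.
Qed.

Lemma heat_parametrix_cont0 : cont0_kernel A LH0.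
Proof.
move=> x y Ax Ay; apply: (@cont0_eq R (fun t =>
  \sum_(z <- neighbours wt x) (H0 x y t - H0 z y t) * wA x z + dparametrix x y t)).
  by move=> t t0; rewrite heat_parametrix.
apply: cont0D; last exact: dparametrix_cont0.
apply: cont0_sum => z; apply: cont0M; last exact: cont0_cst.
by apply: cont0D; [|apply: cont0N]; exact: parametrix_cont0.
Qed.

(** For x outside [s] the weights at x are those of the big graph and all neighbours of x lie in the
    interior, where [H0] equals [Ht]; so the expression is the heat operator of the big graph
    applied to its heat kernel. *)
Lemma heat_parametrix_rows : rows_in A s LH0.
Proof.
move=> x y t Ax; rewrite mem_s => /negP nxs Ay t0.
have ABx : (A `\` B) x by split=> // Bx; apply: nxs; apply/mem_set; left.
have nB'x : ~ B' x by move=> B'x; apply: nxs; apply/mem_set; right.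
rewrite heat_parametrix// /dparametrix (mem_set ABx) (mem_set Ay)/=.
rewrite /dHt /laplacian (sum_wt_neighbours hval (fun z => Ht x y t - Ht z y t)).
apply/eqP; rewrite subr_eq0; apply/eqP; apply: eq_bigr => z _.
rewrite /wA (interior_weight hwt hval hsub z ABx) (parametrix_in ABx)//.
(* Interior z: the kernels agree. Otherwise the weight is 0, for z in [B] because x avoids [B'], for
   z outside [A] because x avoids [B]. *)
have [[Az nBz]|nABz] := pselect ((A `\` B) z); first by rewrite parametrix_in.
have [Az|nAz] := pselect (A z).
  have Bz : B z by apply: contrapT => nBz; apply: nABz.
  by rewrite (deep_interior_weight hwt hval hsub ABx nB'x Bz) !mulr0.
have := interior_weight hwt hval hsub z ABx.
by rewrite /zero_extension memNset// => <-; rewrite !mulr0.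
Qed.

Let F_cont0 : cont0_kernel A F.
Proof. exact: neumann_series_cont0 heat_parametrix_cont0 heat_parametrix_rows. Qed.

Let F_rows : rows_in A s F.
Proof. exact: neumann_series_rows heat_parametrix_cont0 heat_parametrix_rows. Qed.

(** The candidate kernel, written with finitely many scalar convolutions so that it can be
    differentiated term by term. *)
Let U x y t : R := H0 x y t + mconv s H0 F x y t.

Let UE x y t : A x -> A y -> 0 <= t ->
  H0 x y t + convolution A H0 F x y t = U x y t.
Proof.
move=> Ax Ay t0; rewrite (convolution_mconv s_uniq sA)//.
by move=> v z _ _; exact: parametrix_cont0.
Qed.

Let U_cont0 x y : A y -> cont0 (U x y).
Proof.
move=> Ay; apply: cont0D; first exact: parametrix_cont0.
apply: cont0_sumr => v /sA Av.
by apply: cconv_cont0; [exact: parametrix_cont0|exact: F_cont0].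
Qed.

Let U_boundary x y t : B x -> 0 <= t -> U x y t = 0.
Proof.
move=> Bx t0; have H0x v r : H0 x v r = 0.
  by rewrite parametrix_out// => -[[_]].
rewrite /U H0x add0r /mconv big1// => v _.
by rewrite -[RHS](cconv0l (F v y) t); apply: eq_cconv => // r _.
Qed.

Let U_initial x y : (A `\` B) x -> A y -> U x y 0 = (x == y)%:R.
Proof.
move=> ABx Ay; rewrite /U parametrix_initial// /mconv big1 ?addr0// => v _.
exact: cconv_0.
Qed.

Let U_derive x y (t : R) : (A `\` B) x -> A y -> 0 < t ->
  is_derive t 1 (U x y)
    (dparametrix x y t + (F x y t + mconv s dparametrix F x y t)).
Proof.
move=> ABx Ay t0; have Ax := ABx.1.
have dsum : is_derive t 1 (\sum_(v <- s) cconv (H0 x v) (F v y))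
    (\sum_(v <- s) (H0 x v 0 * F v y t + cconv (dparametrix x v) (F v y) t)).
  apply: is_derive_sum_seq => v vs.
  apply: cconv_derive => //; [exact: parametrix_cont0|exact: dparametrix_cont0| |].
    by apply: F_cont0 => //; exact: sA.
  by move=> r r0; exact: parametrix_derive.
have -> : F x y t + mconv s dparametrix F x y t =
    \sum_(v <- s) (H0 x v 0 * F v y t + cconv (dparametrix x v) (F v y) t).
  rewrite big_split/=; congr (_ + _).
  (* The endpoint terms carry [H0 x v 0], a Kronecker delta. For x in [s] it selects F(x, y); for x
     outside [s] nothing is selected, in accordance with the zero row of [F]. *)
  have [xs|xs] := boolP (x \in s).
    rewrite (bigD1_seq x)//= parametrix_initial// eqxx mul1r big1_seq ?addr0//.
    move=> v /andP[vx vs]; rewrite parametrix_initial//; last exact: sA.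
    by rewrite eq_sym (negbTE vx) mul0r.
  rewrite F_rows//; last exact: ltW.
  rewrite big1_seq// => v /= vs; rewrite parametrix_initial//; last exact: sA.
  by rewrite (_ : x == v = false) ?mul0r//; apply: contraNF xs => /eqP->.
have -> : U x y = H0 x y + \sum_(v <- s) cconv (H0 x v) (F v y).
  by apply/funext => r; rewrite /U /mconv fctE fct_sumE.
by apply: is_deriveD => //; exact: parametrix_derive.
Qed.

(** L acts on the first variable and so passes through a convolution on the right, apart from the
    endpoint term, which is accounted for separately in [U_derive]. *)
Let heat_mconv x y t : A x -> A y -> 0 <= t ->
  \sum_(z <- neighbours wt x) (mconv s H0 F x y t - mconv s H0 F z y t) * wA x z
  + mconv s dparametrix F x y t = mconv s LH0 F x y t.
Proof.
move=> Ax Ay t0.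
have step v : v \in s -> cconv (LH0 x v) (F v y) t =
    \sum_(z <- neighbours wt x)
      (cconv (H0 x v) (F v y) t - cconv (H0 z v) (F v y) t) * wA x z
    + cconv (dparametrix x v) (F v y) t.
  move=> /sA Av; have cF := F_cont0 Av Ay.
  have cH z := @parametrix_cont0 z v.
  (* The summand of the Laplacian, split into scalar multiples so that linearity of [cconv]
     applies. *)
  pose G z r := wA x z * H0 x v r + (- wA x z) * H0 z v r.
  have cG z : cont0 (G z).
    by apply: cont0D; apply: cont0M;
      [exact: cont0_cst|exact: cH|exact: cont0_cst|exact: cH].
  rewrite (@eq_cconv R _ (fun r =>
      \sum_(z <- neighbours wt x) G z r + dparametrix x v r) _ (F v y))//; last first.
    move=> r /andP[r0 _]; rewrite heat_parametrix//; congr (_ + _).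
    by apply: eq_bigr => z _; rewrite /G; ring.
  rewrite cconvDl//; last 2 first.
  - exact: cont0_sum.
  - exact: dparametrix_cont0.
  congr (_ + _); rewrite cconv_suml//; apply: eq_bigr => z _.
  rewrite /G cconvDl//; last 2 first.
  - by apply: cont0M => //; exact: cont0_cst.
  - by apply: cont0M => //; exact: cont0_cst.
  by rewrite !cconvZl//; ring.
rewrite /mconv [RHS](eq_big_seq _ step) big_split/=; congr (_ + _).
rewrite exchange_big/=; apply: eq_bigr => z _.
by rewrite -sumrB mulr_suml.
Qed.

(** The total is K + F + K * F, which the resolvent identity makes 0. *)
Let U_heat x y t : (A `\` B) x -> A y -> 0 < t ->
  laplacian A w (fun v => U v y t) x +
  (dparametrix x y t + (F x y t + mconv s dparametrix F x y t)) = 0.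
Proof.
move=> ABx Ay t0; have Ax := ABx.1; have t0' := ltW t0.
rewrite (laplacian_sum hval hsub)//.
have -> : \sum_(z <- neighbours wt x) (U x y t - U z y t) * zero_extension w A x z =
    \sum_(z <- neighbours wt x) (H0 x y t - H0 z y t) * wA x z +
    \sum_(z <- neighbours wt x)
      (mconv s H0 F x y t - mconv s H0 F z y t) * wA x z.
  by rewrite -big_split/=; apply: eq_bigr => z _; rewrite /U /wA; ring.
have K1 := heat_parametrix y Ax t0'.
have K2 := heat_mconv Ax Ay t0'.
have K3 := neumann_series_resolvent s_uniq sA heat_parametrix_cont0
  heat_parametrix_rows Ax Ay t0'.
rewrite -/F -K2 K1 in K3.
by rewrite K3; ring.
Qed.

(** Uniformity in the row is inherited from the heat kernel of the big graph, one column at a time;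
    only the finitely many columns in [s], and y itself, occur. *)
Let U_bounded : locally_bounded_kernel A U.
Proof.
move=> y Ay T; have [_ _ bH] := hHt.
have bH0 v : exists M : R, forall x t, A x -> 0 <= t <= T -> `|H0 x v t| <= M.
  have [M bM] := bH v I T; exists `|M| => x t _ tT.
  rewrite /H0 /parametrix; case: ifPn => _; last by rewrite normr0.
  by rewrite (le_trans (bM x t I tT))// ler_norm.
have [M bM] := bH0 y.
have [v c d bc cd x t Ax tT|v vs|C C0 bC] := @finite_uniform_bound R _ s
  (fun v c => forall x t, A x -> 0 <= t <= T ->
     `|cconv (H0 x v) (F v y) t| <= c).
- exact: le_trans (bc x t Ax tT) cd.
- have Av := sA vs; have [N bN] := bH0 v.
  have [c c0 bc] := cont0_bounded T (F_cont0 Av Ay).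
  exists (`|N| * c * T) => x t Ax /andP[t0 tT].
  apply: (@le_trans _ _ (`|N| * c * (t ^+ 1 / 1%:R))).
    apply: cconv_bound => //; [exact: parametrix_cont0|exact: F_cont0| |].
      move=> r /andP[r0 rt]; rewrite expr0 mulr1 (le_trans _ (ler_norm N))//.
      by apply: bN => //; rewrite r0 (le_trans rt).
    by move=> r /andP[r0 rt]; apply: bc; rewrite r0 (le_trans rt).
  by rewrite expr1 divr1 ler_wpM2l// mulr_ge0.
exists (M + \sum_(v <- s) C) => x t Ax tT.
rewrite /U (le_trans (ler_normD _ _))// lerD//; first exact: bM.
rewrite /mconv (le_trans (ler_norm_sum _ _ _))//.
by rewrite big_seq [leRHS]big_seq; apply: ler_sum => v vs; exact: bC.
Qed.

(** Stated for every [HD] that satisfies the formula on the domain, so that it serves both for the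
    formula itself and for an arbitrary kernel with free values elsewhere. *)
Lemma parametrix_dirichlet_heat_kernel HD :
  (forall x y t, A x -> A y -> 0 <= t ->
    HD x y t = H0 x y t + convolution A H0 F x y t) ->
  is_dirichlet_heat_kernel A B w HD.
Proof.
move=> HDE; have {}HDE x y t : A x -> A y -> 0 <= t -> HD x y t = U x y t.
  by move=> Ax Ay t0; rewrite HDE// UE.
split.
- move=> x y ABx Ay t t0; have Ax := ABx.1.
  have d : is_derive t 1 (HD x y)
      (dparametrix x y t + (F x y t + mconv s dparametrix F x y t)).
    apply: near_eq_is_derive (U_derive ABx Ay t0).
    near=> r; rewrite HDE//; apply/ltW; near: r; exact: lt_nbhsr.
  split; first by case: d.
  rewrite /heat_operator (time_derivative_pos t0 d) -(U_heat ABx Ay t0).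
  congr (_ + _); apply: eq_fsbigr => z /set_mem Az.
  by rewrite !HDE// ltW.
- move=> x y ABx Ay; have Ax := ABx.1.
  rewrite /initial_delta_at -(U_initial ABx Ay) -HDE//.
  apply: cont0_cvg_initial; apply: (cont0_eq _ (@U_cont0 x y Ay)) => t t0.
  by rewrite HDE.
- by move=> x y t Bx Ay t0; rewrite HDE ?U_boundary//; case: Bx.
- move=> y Ay T; have [M bM] := U_bounded Ay T; exists M => x t Ax tT.
  by rewrite HDE ?bM//; case/andP: tT.
Unshelve. all: end_near. Qed.

Lemma parametrix_series_converges (C : set (spacetime R V)) :
  compact C -> C `<=` spacetime_domain A ->
  abs_unif_converges C (neumann_term A LH0) F.
Proof.
exact: (neumann_series_converges s_uniq sA heat_parametrix_cont0
  heat_parametrix_rows).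
Qed.

End Parametrix.

(** The equivalence contains existence and uniqueness: the formula defines a Dirichlet heat kernel,
    and comparison with it identifies any other one on the domain. *)
Theorem proposition15 (R : realType) (V : choiceType) (wt : V -> V -> R)
  (A : set V) (w : V -> V -> R) (Ht : V -> V -> R -> R)
  (hwt : weighted_graph [set: V] wt)
  (hval : bounded_valence [set: V] wt)
  (hsub : subgraph A w [set: V] wt)
  (hbd : finite_set (boundary A w [set: V] wt))
  (hbd' : finite_set (boundary (A `\` boundary A w [set: V] wt) w A w))
  (hHt : is_heat_kernel [set: V] wt Ht) :
  let B := boundary A w [set: V] wt in
  let H0 := parametrix A B Ht in
  let LH0 := heat_operator A w H0 in
  let F := neumann_series A LH0 in
  (forall K : set (spacetime R V), compact K -> K `<=` spacetime_domain A ->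
     abs_unif_converges K (neumann_term A LH0) F) /\
  (forall HD : V -> V -> R -> R,
     is_dirichlet_heat_kernel A B w HD <->
     (forall v1 v2 t, A v1 -> A v2 -> 0 <= t ->
        HD v1 v2 t = H0 v1 v2 t + convolution A H0 F v1 v2 t)).
Proof.
move=> B H0 LH0 F; split.
  exact: parametrix_series_converges hwt hval hsub hbd hbd' hHt.
move=> HD; split=> [HDd v1 v2 t Av1 Av2 t0|HDE].
  have Ud := parametrix_dirichlet_heat_kernel hwt hval hsub hbd hbd' hHt
    (HD := fun v1 v2 t => H0 v1 v2 t + convolution A H0 F v1 v2 t)
    (fun _ _ _ _ _ _ => erefl).
  exact: (dirichlet_heat_kernel_unique hwt hval hsub HDd Ud).
exact: (parametrix_dirichlet_heat_kernel hwt hval hsub hbd hbd' hHt HDE).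
Qed.
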